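(* \textsc{\#Temporal Path} is fixed-parameter tractable when parameterised by the feedback edge number of the underlying graph of the input temporal graph.
   Context: A temporal graph with lifetime $T\in\mathbb{N}$ is a triple $\mathcal{G}=(V,\mathcal{E},T)$ with time-edge set $\mathcal{E}\subseteq\binom{V}{2}\times[T]$; its underlying graph is the static graph on $V$ with edge set $\{\{u,v\}: \exists t, (\{u,v\},t)\in\mathcal{E}\}$. A temporal $(s,z)$-path is a sequence $((\{v_{i-1},v_i\},t_i))_{i=1}^k$ of time-edges in $\mathcal{E}$ with $v_0=s$, $v_k=z$, the vertices $v_0,\dots,v_k$ pairwise distinct, and $t_i\le t_{i+1}$ for all $i\in[k-1]$. \textsc{\#Temporal Path}: given $\mathcal{G}$ and $s,z\in V$, count the temporal $(s,z)$-paths in $\mathcal{G}$. The feedback edge number of a graph is the minimum number of edges whose removal leaves a forest. *)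

(* Defs.v *)
From HB Require Import structures.
From mathcomp Require Import all_boot.

Set Implicit Arguments.
Unset Strict Implicit.
Unset Printing Implicit Defensive.

(** * Model of computation: random access machines with logarithmic cost

    The usual RAM over natural numbers, with structured control flow in place
    of jumps.  A program uses finitely many registers, named by constants, and
    an unbounded memory that is addressed through registers.  There is neither
    multiplication nor division, and every instruction is charged the total
    binary length of the numbers (data and addresses) it handles, so running
    times agree with those of multitape Turing machines up to a polynomial. *)

Inductive prog : Type :=
| Const of nat & nat          (* r_d := a *)
| Add of nat & nat & nat      (* r_d := r_i + r_j *)
| Sub of nat & nat & nat      (* r_d := r_i - r_j, truncated at 0 *)
| Read of nat & nat           (* r_d := mem[r_i] *)
| Write of nat & nat          (* mem[r_i] := r_j *)
| Seq of prog & prog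
| If of nat & prog & prog     (* if r_i > 0 then .. else .. *)
| While of nat & prog.        (* while r_i > 0 do .. *)

Record state := State { regs : nat -> nat; mem : nat -> nat }.

Definition upd (f : nat -> nat) (i a : nat) : nat -> nat :=
  fun j => if j == i then a else f j.

Definition set_reg (st : state) (d a : nat) : state :=
  State (upd (regs st) d a) (mem st).

Definition set_mem (st : state) (i a : nat) : state :=
  State (regs st) (upd (mem st) i a).

(* Length of the binary expansion; [bitlen 0 = 1] since [trunc_log 2 0 = 0]. *)
Definition bitlen (a : nat) : nat := (trunc_log 2 a).+1.

(* [exec p st t st'] : started in [st], [p] halts in [st'] after time [t]. *)
Inductive exec : prog -> state -> nat -> state -> Prop :=
| ExecConst st d a :
    exec (Const d a) st (bitlen a) (set_reg st d a)
| ExecAdd st d i j :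
    exec (Add d i j) st (bitlen (regs st i) + bitlen (regs st j))
      (set_reg st d (regs st i + regs st j))
| ExecSub st d i j :
    exec (Sub d i j) st (bitlen (regs st i) + bitlen (regs st j))
      (set_reg st d (regs st i - regs st j))
| ExecRead st d i :
    exec (Read d i) st (bitlen (regs st i) + bitlen (mem st (regs st i)))
      (set_reg st d (mem st (regs st i)))
| ExecWrite st i j :
    exec (Write i j) st (bitlen (regs st i) + bitlen (regs st j))
      (set_mem st (regs st i) (regs st j))
| ExecSeq p q st st1 st2 t1 t2 :
    exec p st t1 st1 -> exec q st1 t2 st2 ->
    exec (Seq p q) st (t1 + t2) st2
| ExecIfTrue i p q st st1 t :
    0 < regs st i -> exec p st t st1 ->
    exec (If i p q) st (bitlen (regs st i) + t) st1
| ExecIfFalse i p q st st1 t :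
    regs st i = 0 -> exec q st t st1 ->
    exec (If i p q) st (bitlen (regs st i) + t) st1
| ExecWhileTrue i p st st1 st2 t1 t2 :
    0 < regs st i -> exec p st t1 st1 -> exec (While i p) st1 t2 st2 ->
    exec (While i p) st (bitlen (regs st i) + t1 + t2) st2
| ExecWhileFalse i p st :
    regs st i = 0 -> exec (While i p) st (bitlen (regs st i)) st.

(* An input word is a finite sequence of numbers, stored in the memory cells
   0, 1, 2, ...; register 0 initially holds its length.  Everything else is 0.
   The output is the final content of register 0. *)
Definition init (w : seq nat) : state :=
  State (upd (fun=> 0) 0 (size w)) (nth 0 w).

Definition output (st : state) : nat := regs st 0.

Definition input_size (w : seq nat) : nat := \sum_(a <- w) bitlen a.

Definition computable (f : nat -> nat) : Prop :=
  exists p : prog, forall k : nat,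
    exists (t : nat) (st : state), exec p (init [:: k]) t st /\ output st = f k.

(** * Fixed-parameter tractable counting problems

    [encodes x w] : the word [w] is an encoding of the instance [x].  The
    algorithm has to be correct, within time [f (param x) * |w| ^ c], on every
    encoding of every instance, and the parameter is not part of its input. *)
Definition fixed_parameter_tractable (I : Type) (encodes : I -> seq nat -> Prop)
    (count : I -> nat) (param : I -> nat) : Prop :=
  exists (p : prog) (f : nat -> nat) (c : nat),
    computable f /\
    forall (x : I) (w : seq nat), encodes x w ->
      exists (t : nat) (st : state),
        [/\ exec p (init w) t st,
            output st = count x &
            t <= f (param x) * input_size w ^ c].

(** * Static graphs

    A static graph on [V] is given by its edge set, a set of 2-element subsets
    of [V]. *)
Section StaticGraphs.
Variable V : finType.
Implicit Types A F : {set {set V}}.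

Definition adjacent A : rel V := [rel u v | [set u; v] \in A].

(* A cycle without repeated vertices has at most [#|V|] vertices, so the bound
   on the length of [c] excludes nothing. *)
Definition is_forest A : bool :=
  [forall c : {bseq #|V| of V},
     ~~ [&& 2 < size c, uniq c & cycle (adjacent A) c]].

Definition feedback_edge_set A F : bool :=
  (F \subset A) && is_forest (A :\: F).

Definition feedback_edge_number A : nat :=
  #|[arg min_(F < A | feedback_edge_set A F) #|F|]|.

Lemma feedback_edge_setT A : feedback_edge_set A A.
Proof.
rewrite /feedback_edge_set subxx setDv; apply/forallP => -[[|u [|v c]] sz_c] //.
by apply/negP => /and3P[_ _] /=; rewrite /adjacent /= in_set0.
Qed.

Lemma is_forestP A :
  reflect (forall c : seq V, uniq c -> 2 < size c -> ~~ cycle (adjacent A) c)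
          (is_forest A).
Proof.
apply: (iffP forallP) => [forA c Uc c_gt2 | forA c]; last first.
  by apply/negP => /and3P[c_gt2 Uc]; apply/negP/forA.
have sz_c : size c <= #|V| by rewrite -(card_uniqP Uc) max_card.
by have:= forA (Bseq sz_c); rewrite /= c_gt2 Uc.
Qed.

End StaticGraphs.

(** * Temporal graphs *)

(* The label [t : 'I_T] stands for the time [t.+1] of [T] = {1, ..., T}. *)
Record temporal_graph := TemporalGraph {
  vertex : finType;
  lifetime : nat;
  time_edges : {set {set vertex} * 'I_lifetime};
  time_edges_card2 : forall e, e \in time_edges -> #|e.1| = 2
}.

Section TemporalPaths.
Variable G : temporal_graph.
Local Notation V := (vertex G).
Local Notation time_edge := ({set V} * 'I_(lifetime G))%type.

Definition underlying_graph : {set {set V}} :=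
  [set e.1 | e in time_edges G].

(* [vs] lists v_1, ..., v_k; the mapped sequence is
   {v_0, v_1}, ..., {v_(k-1), v_k}. *)
Definition is_temporal_path (s z : V) (p : seq time_edge) : bool :=
  [exists vs : (size p).-tuple V,
     [&& all [in time_edges G] p,
         [seq e.1 | e <- p] == pairmap (fun u v => [set u; v]) s vs,
         last s vs == z,
         uniq (s :: vs) &
         sorted leq [seq val e.2 | e <- p]]].

Lemma size_temporal_path (s z : V) (p : seq time_edge) :
  is_temporal_path s z p -> size p < #|V|.
Proof.
case/existsP => vs /and5P[_ _ _ Uvs _].
by rewrite -(size_tuple vs) -[(size vs).+1]/(size (s :: vs)) -(card_uniqP Uvs)
           max_card.
Qed.

(* By [size_temporal_path], the bound on the length of [p] excludes nothing. *)
Definition num_temporal_paths (s z : V) : nat :=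
  #|[set p : {bseq #|V| of time_edge} | is_temporal_path s z p]|.

End TemporalPaths.

(** * The problem #Temporal Path *)

Record tp_instance := TPInstance {
  tp_graph : temporal_graph;
  source : vertex tp_graph;
  target : vertex tp_graph
}.

(* The vertices are named 0, ..., |V| - 1 in an arbitrary way, and the
   time-edges are listed explicitly, each exactly once, in arbitrary order and
   with their endpoints in arbitrary order. *)
Definition tp_encodes (x : tp_instance) (w : seq nat) : Prop :=
  let G := tp_graph x in
  exists (name : vertex G -> nat)
         (es : seq (vertex G * vertex G * 'I_(lifetime G))),
    [/\ injective name,
        forall v, name v < #|vertex G|,
        perm_eq [seq ([set e.1.1; e.1.2], e.2) | e <- es] (enum (time_edges G)) &
        w = [:: #|vertex G|; lifetime G; size es; name (source x); name (target x)]
            ++ iota 0 #|vertex G|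
            ++ flatten [seq [:: name e.1.1; name e.1.2; (val e.2).+1] | e <- es]].

Definition count_temporal_paths (x : tp_instance) : nat :=
  num_temporal_paths (source x) (target x).

Definition fen_underlying (x : tp_instance) : nat :=
  feedback_edge_number (underlying_graph (tp_graph x)).

(* Main.v *)
(** A path in the underlying graph is determined by its ends and by the edges of
    a fixed feedback edge set [F] that it uses: the symmetric difference of two
    paths with the same ends has only even degrees, so if it avoids [F] it is
    an even subgraph of a forest, hence empty.  There are thus at most
    [n * 2 ^ k] simple paths from [s], and all of them can be enumerated by
    plain breadth-first search.  Along each path, a dynamic program over the
    time-edges counts the temporal paths.

    Machine programs are written in a language of bounded loops.  It suffices to
    count their steps: without multiplication, [n] steps lengthen the numbers
    by at most [n] bits, so the logarithmic cost is at most quadratic in [n]. *)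

From HB Require Import structures.
From mathcomp Require Import all_boot zify.
Require Import Defs.

Set Implicit Arguments.
Unset Strict Implicit.
Unset Printing Implicit Defensive.

(** * Programs with bounded loops *)

(** The feedback edge set lives in the analysis only: the program neither computes one nor knows its
    size, and it never consults the underlying graph. A path is kept when it is simple and carries
    at least one temporal path. This forces its edges into the underlying graph, so the bound on
    simple paths applies; and it passes to prefixes, so pruning loses nothing. Both tests are read
    off one cell of the table of the path. Only the first [#|V|] levels of the search can be
    nonempty, so loops whose round count is fixed on entry suffice. Every loop runs at most [S]
    rounds, where [S] is the input size times [2 ^ k]. The step count is thus polynomial in [S], and
    a power of [S] splits into a function of [k] times a power of the input size. *)

Inductive uexec : prog -> state -> nat -> state -> Prop :=
| UConst st d a : uexec (Const d a) st 1 (set_reg st d a)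
| UAdd st d i j :
    uexec (Add d i j) st 1 (set_reg st d (regs st i + regs st j))
| USub st d i j :
    uexec (Sub d i j) st 1 (set_reg st d (regs st i - regs st j))
| URead st d i : uexec (Read d i) st 1 (set_reg st d (mem st (regs st i)))
| UWrite st i j :
    uexec (Write i j) st 1 (set_mem st (regs st i) (regs st j))
| USeq p q st st1 st2 n1 n2 :
    uexec p st n1 st1 -> uexec q st1 n2 st2 ->
    uexec (Seq p q) st (n1 + n2) st2
| UIfTrue i p q st st1 n :
    0 < regs st i -> uexec p st n st1 -> uexec (If i p q) st n.+1 st1
| UIfFalse i p q st st1 n :
    regs st i = 0 -> uexec q st n st1 -> uexec (If i p q) st n.+1 st1
| UWhileTrue i p st st1 st2 n1 n2 :
    0 < regs st i -> uexec p st n1 st1 -> uexec (While i p) st1 n2 st2 ->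
    uexec (While i p) st (n1 + n2).+1 st2
| UWhileFalse i p st : regs st i = 0 -> uexec (While i p) st 1 st.

Fixpoint max_const (p : prog) : nat :=
  match p with
  | Const _ a => a
  | Seq p q | If _ p q => maxn (max_const p) (max_const q)
  | While _ p => max_const p
  | _ => 0
  end.

Definition bounded (b : nat) (st : state) : Prop :=
  forall x, regs st x < 2 ^ b /\ mem st x < 2 ^ b.

Lemma bitlen_le b a : 0 < b -> a < 2 ^ b -> bitlen a <= b.
Proof.
move=> b_gt0 lt_ab; rewrite /bitlen; case: (posnP a) => [->|a_gt0].
  by rewrite trunc_log0.
rewrite -(ltn_exp2l _ _ (isT : 1 < 2)); apply: leq_ltn_trans lt_ab.
exact: trunc_logP.
Qed.

Lemma bounded_set_reg b st d a :
  bounded b st -> a < 2 ^ b.+1 -> bounded b.+1 (set_reg st d a).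
Proof.
move=> bst lt_a x; have [lt_r lt_m] := bst x.
have le_b : 2 ^ b <= 2 ^ b.+1 by rewrite leq_exp2l.
split; last exact: leq_trans lt_m _.
by rewrite /= /upd; case: eqP => // _; exact: leq_trans lt_r _.
Qed.

Lemma bounded_set_mem b st i a :
  bounded b st -> a < 2 ^ b -> bounded b.+1 (set_mem st i a).
Proof.
move=> bst lt_a x; have [lt_r lt_m] := bst x.
have le_b : 2 ^ b <= 2 ^ b.+1 by rewrite leq_exp2l.
split; first exact: leq_trans lt_r _.
rewrite /= /upd; case: eqP => // _; [exact: leq_trans lt_a _|].
exact: leq_trans lt_m _.
Qed.

(* Without multiplication an instruction at most doubles the largest number
   around, so after [n] steps all numbers have at most [b + n] bits. *)
Lemma exec_of_uexec p st n st' b :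
    uexec p st n st' -> max_const p < 2 ^ b -> 0 < b -> bounded b st ->
  bounded (b + n) st' /\
  forall B, b + n <= B -> exists2 t, exec p st t st' & t <= n * (2 * B).
Proof.
(* One rate [B] has to serve the whole run although the numbers grow, hence every [B] above the
   final length is allowed. The factor 2 arises because an instruction handles at most two
   numbers. *)
move=> ex; elim: ex b => {p st n st'}
  [st d a|st d i j|st d i j|st d i|st i j|p q st st1 st2 n1 n2 _ IH1 _ IH2
  |i p q st st1 n ri _ IH|i p q st st1 n ri _ IH
  |i p st st1 st2 n1 n2 ri _ IH1 _ IH2|i p st ri] b /= ltc b_gt0 bst.
- have le_b : 2 ^ b <= 2 ^ b.+1 by rewrite leq_exp2l.
  split=> [|B le_B]; first by rewrite addn1; apply: bounded_set_reg => //; lia.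
  exists (bitlen a); first by constructor.
  by have := bitlen_le b_gt0 ltc; lia.
- have [lt_i _] := bst i; have [lt_j _] := bst j.
  split=> [|B le_B].
    by rewrite addn1; apply: bounded_set_reg; rewrite ?expnS //; lia.
  exists (bitlen (regs st i) + bitlen (regs st j)); first by constructor.
  by have := bitlen_le b_gt0 lt_i; have := bitlen_le b_gt0 lt_j; lia.
- have [lt_i _] := bst i; have [lt_j _] := bst j.
  split=> [|B le_B].
    by rewrite addn1; apply: bounded_set_reg; rewrite ?expnS //; lia.
  exists (bitlen (regs st i) + bitlen (regs st j)); first by constructor.
  by have := bitlen_le b_gt0 lt_i; have := bitlen_le b_gt0 lt_j; lia.
- have [lt_i _] := bst i; have [_ lt_m] := bst (regs st i).
  split=> [|B le_B].
    by rewrite addn1; apply: bounded_set_reg; rewrite ?expnS //; lia.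
  exists (bitlen (regs st i) + bitlen (mem st (regs st i))).
    by constructor.
  by have := bitlen_le b_gt0 lt_i; have := bitlen_le b_gt0 lt_m; lia.
- have [lt_i _] := bst i; have [lt_j _] := bst j.
  split=> [|B le_B]; first by rewrite addn1; apply: bounded_set_mem.
  exists (bitlen (regs st i) + bitlen (regs st j)); first by constructor.
  by have := bitlen_le b_gt0 lt_i; have := bitlen_le b_gt0 lt_j; lia.
- have [] := IH1 b _ b_gt0 bst; first by lia.
  move=> b1 T1; have [||] := IH2 (b + n1) _ _ b1.
  + by have := leq_pexp2l (isT : 0 < 2) (leq_addr n1 b); rewrite /=; lia.
  + by lia.
  move=> b2 T2; rewrite addnA; split=> // B le_B.
  have [|t1 ex1 le1] := T1 B; first by lia.
  have [|t2 ex2 le2] := T2 B; first by lia.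
  by exists (t1 + t2); [apply: ExecSeq ex1 ex2 | rewrite mulnDl leq_add].
- have [] := IH b _ b_gt0 bst; first by lia.
  move=> b1 T1; split=> [x|B le_B].
    by have [? ?] := b1 x; rewrite addnS expnS; lia.
  have [|t ex le1] := T1 B; first by lia.
  exists (bitlen (regs st i) + t); first exact: ExecIfTrue.
  by have := bitlen_le b_gt0 (bst i).1; rewrite mulSn; lia.
- have [] := IH b _ b_gt0 bst; first by lia.
  move=> b1 T1; split=> [x|B le_B].
    by have [? ?] := b1 x; rewrite addnS expnS; lia.
  have [|t ex le1] := T1 B; first by lia.
  exists (bitlen (regs st i) + t); first exact: ExecIfFalse.
  by have := bitlen_le b_gt0 (bst i).1; rewrite mulSn; lia.
- have [] := IH1 b _ b_gt0 bst => //.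
  move=> b1 T1; have [||] := IH2 (b + n1) _ _ b1.
  + by have := leq_pexp2l (isT : 0 < 2) (leq_addr n1 b); rewrite /=; lia.
  + by lia.
  move=> b2 T2; split=> [x|B le_B].
    by have [? ?] := b2 x; rewrite addnS expnS addnA; lia.
  have [|t1 ex1 le1] := T1 B; first by lia.
  have [|t2 ex2 le2] := T2 B; first by lia.
  exists (bitlen (regs st i) + t1 + t2); first exact: ExecWhileTrue ex1 ex2.
  by have := bitlen_le b_gt0 (bst i).1; rewrite mulSn mulnDl; lia.
- split=> [x|B le_B].
    by have [? ?] := bst x; rewrite addn1 expnS; lia.
  exists (bitlen (regs st i)); first exact: ExecWhileFalse.
  by have := bitlen_le b_gt0 (bst i).1; lia.
Qed.

Inductive expr : Type :=
| Cst of nat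
| Var of nat
| Plus of expr & expr
| Minus of expr & expr
| Mem of expr.

Inductive cmd : Type :=
| Skip
| Asg of nat & expr
| Sto of expr & expr
| Sqc of cmd & cmd
| Ite of expr & cmd & cmd
| Rep of expr & cmd.

Fixpoint eval (e : expr) (st : state) : nat :=
  match e with
  | Cst a => a
  | Var x => regs st x
  | Plus e1 e2 => eval e1 st + eval e2 st
  | Minus e1 e2 => eval e1 st - eval e2 st
  | Mem e => mem st (eval e st)
  end.

(** A loop evaluates its count once, on entry, so every command terminates and has a total
    denotation. *)
Fixpoint den (c : cmd) (st : state) : state :=
  match c with
  | Skip => st
  | Asg x e => set_reg st x (eval e st)
  | Sto e1 e2 => set_mem st (eval e1 st) (eval e2 st)
  | Sqc c1 c2 => den c2 (den c1 st)
  | Ite e c1 c2 => if 0 < eval e st then den c1 st else den c2 st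
  | Rep e c => iter (eval e st) (den c) st
  end.

Fixpoint ecost (e : expr) : nat :=
  match e with
  | Cst _ => 1
  | Var _ => 2
  | Plus e1 e2 | Minus e1 e2 => ecost e1 + ecost e2 + 1
  | Mem e => ecost e + 1
  end.

(** The exact step count of the compiled code. A round adds three steps, one for the test and two
    for the decrement; the failing test at the end adds one. *)
Fixpoint cost (c : cmd) (st : state) : nat :=
  match c with
  | Skip => 1
  | Asg _ e => ecost e + 2
  | Sto e1 e2 => ecost e1 + ecost e2 + 1
  | Sqc c1 c2 => cost c1 st + cost c2 (den c1 st)
  | Ite e c1 c2 =>
      ecost e + (if 0 < eval e st then cost c1 st else cost c2 st).+1
  | Rep e c =>
      ecost e +
      (\sum_(i < eval e st) (cost c (iter i (den c) st)).+3).+1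
  end.

(** The registers from [k] on form an evaluation stack, and the result is left in [k]. A copy is an
    addition of zero, as the machine has no move instruction. *)
Fixpoint ecomp (k : nat) (e : expr) : prog :=
  match e with
  | Cst a => Const k a
  | Var x => Seq (Const k 0) (Add k x k)
  | Plus e1 e2 => Seq (Seq (ecomp k e1) (ecomp k.+1 e2)) (Add k k k.+1)
  | Minus e1 e2 => Seq (Seq (ecomp k e1) (ecomp k.+1 e2)) (Sub k k k.+1)
  | Mem e => Seq (ecomp k e) (Read k k)
  end.

(* The registers from [k] on are scratch space; a loop keeps the number of
   remaining rounds in register [k]. *)
Fixpoint comp (k : nat) (c : cmd) : prog :=
  match c with
  | Skip => Const k 0
  | Asg x e => Seq (ecomp k e) (Seq (Const k.+1 0) (Add x k k.+1))
  | Sto e1 e2 => Seq (Seq (ecomp k e1) (ecomp k.+1 e2)) (Write k k.+1)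
  | Sqc c1 c2 => Seq (comp k c1) (comp k c2)
  | Ite e c1 c2 => Seq (ecomp k e) (If k (comp k.+1 c1) (comp k.+1 c2))
  | Rep e c =>
      Seq (ecomp k e)
        (While k (Seq (comp k.+1 c) (Seq (Const k.+1 1) (Sub k k k.+1))))
  end.

Fixpoint vars_below (K : nat) (e : expr) : bool :=
  match e with
  | Cst _ => true
  | Var x => x < K
  | Plus e1 e2 | Minus e1 e2 => vars_below K e1 && vars_below K e2
  | Mem e => vars_below K e
  end.

Fixpoint cvars_below (K : nat) (c : cmd) : bool :=
  match c with
  | Skip => true
  | Asg x e => (x < K) && vars_below K e
  | Sto e1 e2 => vars_below K e1 && vars_below K e2
  | Sqc c1 c2 => cvars_below K c1 && cvars_below K c2
  | Ite e c1 c2 => [&& vars_below K e, cvars_below K c1 & cvars_below K c2]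
  | Rep e c => vars_below K e && cvars_below K c
  end.

(** * Correctness of the compiler *)

Definition agree (K : nat) (st hs : state) : Prop :=
  (forall x, x < K -> regs st x = regs hs x) /\ mem st = mem hs.

(** Pending operands and loop counters of the enclosing commands lie between [K] and [k]; inner code
    must preserve them. *)
Definition same_scratch (K k : nat) (st st' : state) : Prop :=
  forall x, K <= x < k -> regs st' x = regs st x.

Lemma updE f i a j : upd f i a j = if j == i then a else f j.
Proof. by []. Qed.

Lemma ecomp_correct K e k st hs :
    vars_below K e -> K <= k -> agree K st hs ->
  exists st', [/\ uexec (ecomp k e) st (ecost e) st', agree K st' hs,
    regs st' k = eval e hs & same_scratch K k st st'].
Proof.
elim: e k st => [a|x|e1 IH1 e2 IH2|e1 IH1 e2 IH2|e IH] k st /=.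
- move=> _ leKk [agr agm]; exists (set_reg st k a).
  split; [by constructor| |by rewrite /= updE eqxx|].
    by split=> //= x ltx; rewrite updE; case: eqP => [?|_]; [lia|auto].
  by move=> x ltx; rewrite /= updE; case: eqP => [?|_]; [lia|auto].
- move=> ltxK leKk [agr agm].
  exists (set_reg (set_reg st k 0) k (regs st x)).
  split; [|by split=> //= y lty; rewrite !updE; case: eqP => [?|_]; [lia|auto]
         |by rewrite /= updE eqxx agr|].
    rewrite -[2]/(1 + 1); apply: USeq; first by constructor.
    set st1 := set_reg st k 0.
    have -> : regs st x = regs st1 x + regs st1 k.
      by rewrite /= !updE eqxx; case: eqP => [?|_]; [lia|rewrite addn0].
    by constructor.
  by move=> y lty; rewrite /= !updE; case: eqP => [?|_]; [lia|auto].
- move=> /andP[v1 v2] leKk ag.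
  have [st1 [ex1 ag1 r1 sc1]] := IH1 k st v1 leKk ag.
  have [|st2 [ex2 ag2 r2 sc2]] := IH2 k.+1 st1 v2 _ ag1; first by lia.
  exists (set_reg st2 k (regs st2 k + regs st2 k.+1)).
  split; last 2 first.
  + by rewrite /= updE eqxx r2 sc2 ?r1 //; lia.
  + move=> x ltx; rewrite /= updE; case: eqP => [?|_]; first lia.
    by rewrite sc2 ?sc1 //; lia.
  + by apply: USeq; [exact: USeq ex1 ex2|constructor].
  + case: ag2 => agr agm; split=> // x ltx.
    by rewrite /= updE; case: eqP => [?|_]; [lia|auto].
- move=> /andP[v1 v2] leKk ag.
  have [st1 [ex1 ag1 r1 sc1]] := IH1 k st v1 leKk ag.
  have [|st2 [ex2 ag2 r2 sc2]] := IH2 k.+1 st1 v2 _ ag1; first by lia.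
  exists (set_reg st2 k (regs st2 k - regs st2 k.+1)).
  split; last 2 first.
  + by rewrite /= updE eqxx r2 sc2 ?r1 //; lia.
  + move=> x ltx; rewrite /= updE; case: eqP => [?|_]; first lia.
    by rewrite sc2 ?sc1 //; lia.
  + by apply: USeq; [exact: USeq ex1 ex2|constructor].
  + case: ag2 => agr agm; split=> // x ltx.
    by rewrite /= updE; case: eqP => [?|_]; [lia|auto].
- move=> v1 leKk ag; have [st1 [ex1 [agr agm] r1 sc1]] := IH k st v1 leKk ag.
  exists (set_reg st1 k (mem st1 (regs st1 k))); split.
  + by apply: USeq ex1 _; constructor.
  + split=> // x ltx.
    by rewrite /= updE; case: eqP => [?|_]; [lia|auto].
  + by rewrite /= updE eqxx agm r1.
  + by move=> x ltx; rewrite /= updE; case: eqP => [?|_]; [lia|auto].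
Qed.

Lemma comp_correct K c k st hs :
    cvars_below K c -> K <= k -> agree K st hs ->
  exists st', [/\ uexec (comp k c) st (cost c hs) st', agree K st' (den c hs)
    & same_scratch K k st st'].
Proof.
elim: c k st hs => [|x e|e1 e2|c1 IH1 c2 IH2|e c1 IH1 c2 IH2|e c IH] k st hs /=.
- move=> _ leKk [agr agm]; exists (set_reg st k 0).
  split; first by constructor.
    by split=> //= x ltx; rewrite updE; case: eqP => [?|_]; [lia|auto].
  by move=> x ltx; rewrite /= updE; case: eqP => [?|_]; [lia|auto].
- move=> /andP[ltx v] leKk ag.
  have [st1 [ex1 [agr agm] r1 sc1]] := ecomp_correct v leKk ag.
  pose st2 := set_reg st1 k.+1 0.
  exists (set_reg st2 x (regs st2 k + regs st2 k.+1)).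
  have r2 : regs st2 k + regs st2 k.+1 = eval e hs.
    by rewrite /= !updE eqxx addn0; case: eqP => [?|_]; [lia|].
  split.
  + apply: USeq ex1 _; rewrite -[2]/(1 + 1).
    by apply: USeq; constructor.
  + rewrite r2; split=> //= y lty; rewrite !updE.
    by case: eqP => //; case: eqP => [?|_ _]; [lia|auto].
  + move=> y lty; rewrite /= !updE; case: eqP => [?|_]; first lia.
    by case: eqP => [?|_]; [lia|auto].
- move=> /andP[v1 v2] leKk ag.
  have [st1 [ex1 ag1 r1 sc1]] := ecomp_correct v1 leKk ag.
  have [|st2 [ex2 [agr agm] r2 sc2]] := ecomp_correct (k := k.+1) v2 _ ag1.
    by lia.
  exists (set_mem st2 (regs st2 k) (regs st2 k.+1)).
  split.
  + by apply: USeq; [exact: USeq ex1 ex2|constructor].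
  + by split=> //=; rewrite agm r2 sc2 ?r1 //; lia.
  + by move=> y lty; rewrite /= sc2 ?sc1 //; lia.
- move=> /andP[v1 v2] leKk ag.
  have [st1 [ex1 ag1 sc1]] := IH1 k st hs v1 leKk ag.
  have [st2 [ex2 ag2 sc2]] := IH2 k st1 _ v2 leKk ag1.
  exists st2; split=> //; first exact: USeq ex1 ex2.
  by move=> y lty; rewrite sc2 ?sc1.
- move=> /and3P[v v1 v2] leKk ag.
  have [st1 [ex1 ag1 r1 sc1]] := ecomp_correct v leKk ag.
  have leKk1 : K <= k.+1 by lia.
  case: posnP => re.
    have [st2 [ex2 ag2 sc2]] := IH2 k.+1 st1 _ v2 leKk1 ag1.
    exists st2; split=> //.
      by apply: USeq ex1 _; apply: UIfFalse => //; rewrite r1.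
    by move=> y lty; rewrite sc2 ?sc1 //; lia.
  have [st2 [ex2 ag2 sc2]] := IH1 k.+1 st1 _ v1 leKk1 ag1.
  exists st2; split=> //.
    by apply: USeq ex1 _; apply: UIfTrue => //; rewrite r1.
  by move=> y lty; rewrite sc2 ?sc1 //; lia.
- move=> /andP[v v1] leKk ag.
  have [st1 [ex1 ag1 r1 sc1]] := ecomp_correct v leKk ag.
  have leKk1 : K <= k.+1 by lia.
  suff loop n st0 hs0 : agree K st0 hs0 -> regs st0 k = n ->
      exists st', [/\ uexec (While k (Seq (comp k.+1 c)
          (Seq (Const k.+1 1) (Sub k k k.+1)))) st0
          (\sum_(i < n) (cost c (iter i (den c) hs0)).+3).+1 st',
          agree K st' (iter n (den c) hs0) & same_scratch K k st0 st'].
    have [st2 [ex2 ag2 sc2]] := loop _ st1 hs ag1 r1.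
    exists st2; split=> //; first exact: USeq ex1 ex2.
    by move=> y lty; rewrite sc2 ?sc1.
  elim: n st0 hs0 => [|n IHn] st0 hs0 ag0 r0.
    rewrite big_ord0; exists st0; split=> //; exact: UWhileFalse.
  have [st2 [ex2 [agr agm] sc2]] := IH k.+1 st0 _ v1 leKk1 ag0.
  pose st3 := set_reg st2 k.+1 1.
  pose st4 := set_reg st3 k (regs st3 k - regs st3 k.+1).
  have ag4 : agree K st4 (den c hs0).
    split=> // y lty; rewrite /= !updE.
    by case: eqP => [?|_]; [lia|]; case: eqP => [?|_]; [lia|auto].
  have r4 : regs st4 k = n.
    rewrite /= !updE !eqxx; case: eqP => [?|_]; first lia.
    by rewrite sc2 ?r0 ?subn1 //; lia.
  have [st5 [ex5 ag5 sc5]] := IHn st4 _ ag4 r4.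
  exists st5; split; last first.
  + move=> y lty; rewrite sc5 //= !updE.
    case: eqP => [?|_]; first lia.
    by case: eqP => [?|_]; [lia|]; rewrite sc2 //; lia.
  + by rewrite iterSr.
  rewrite big_ord_recl; under eq_bigr do rewrite lift0 iterSr.
  set S := (\sum_(i < n) _) in ex5 *.
  rewrite /= -[X in uexec _ _ X]/((cost c hs0).+3 + S).+1.
  have -> : (cost c hs0).+3 + S = (cost c hs0 + (1 + 1)) + S.+1 by lia.
  apply: UWhileTrue ex5; first by rewrite r0.
  by apply: USeq ex2 _; apply: USeq; constructor.
Qed.

(** * Cost bounds from loop counts *)

Fixpoint mods (c : cmd) : seq nat :=
  match c with
  | Asg x _ => [:: x]
  | Sqc c1 c2 | Ite _ c1 c2 => mods c1 ++ mods c2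
  | Rep _ c => mods c
  | _ => [::]
  end.

Lemma den_frame c st x : x \notin mods c -> regs (den c st) x = regs st x.
Proof.
elim: c st => [|y e|e1 e2|c1 IH1 c2 IH2|e c1 IH1 c2 IH2|e c IH] st //=.
- by rewrite inE /upd => /negPf->.
- by rewrite mem_cat => /norP[n1 n2]; rewrite IH2 ?IH1.
- by rewrite mem_cat => /norP[n1 n2]; case: ifP => _; [apply: IH1|apply: IH2].
- by move=> nx; elim: (eval e st) => //= n IHn; rewrite IH.
Qed.

Lemma iter_den_frame c n st x :
  x \notin mods c -> regs (iter n (den c) st) x = regs st x.
Proof. by move=> nx; elim: n => //= n <-; exact: den_frame. Qed.

(* [scost S c] bounds the cost of [c] when every loop runs at most [S] times. *)
Fixpoint scost (S : nat) (c : cmd) : nat :=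
  match c with
  | Skip => 1
  | Asg _ e => ecost e + 2
  | Sto e1 e2 => ecost e1 + ecost e2 + 1
  | Sqc c1 c2 => scost S c1 + scost S c2
  | Ite e c1 c2 => ecost e + (scost S c1 + scost S c2).+1
  | Rep e c => ecost e + (S * (scost S c).+3).+1
  end.

Fixpoint loop_depth (c : cmd) : nat :=
  match c with
  | Sqc c1 c2 | Ite _ c1 c2 => maxn (loop_depth c1) (loop_depth c2)
  | Rep _ c => (loop_depth c).+1
  | _ => 0
  end.

(** In [S], [scost S c] is a polynomial with nonnegative coefficients and degree at most the loop
    depth; its value at 1 is the sum of the coefficients. *)
Lemma scost_le S c :
  0 < S -> scost S c <= scost 1 c * S ^ loop_depth c.
Proof.
move=> S_gt0; elim: c => [|y e|e1 e2|c1 IH1 c2 IH2|e c1 IH1 c2 IH2|e c IH] /=;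
  rewrite ?muln1 //.
- have l1 : S ^ loop_depth c1 <= S ^ maxn (loop_depth c1) (loop_depth c2).
    by rewrite leq_pexp2l // leq_maxl.
  have l2 : S ^ loop_depth c2 <= S ^ maxn (loop_depth c1) (loop_depth c2).
    by rewrite leq_pexp2l // leq_maxr.
  rewrite mulnDl leq_add //.
    by apply: leq_trans IH1 _; rewrite leq_mul2l l1 orbT.
  by apply: leq_trans IH2 _; rewrite leq_mul2l l2 orbT.
- have l1 : S ^ loop_depth c1 <= S ^ maxn (loop_depth c1) (loop_depth c2).
    by rewrite leq_pexp2l // leq_maxl.
  have l2 : S ^ loop_depth c2 <= S ^ maxn (loop_depth c1) (loop_depth c2).
    by rewrite leq_pexp2l // leq_maxr.
  have := leq_trans IH1 (leq_mul (leqnn _) l1).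
  have := leq_trans IH2 (leq_mul (leqnn _) l2).
  have : 0 < S ^ maxn (loop_depth c1) (loop_depth c2) by rewrite expn_gt0 S_gt0.
  nia.
- rewrite mul1n expnS; have : 0 < S ^ loop_depth c by rewrite expn_gt0 S_gt0.
  by move: IH; nia.
Qed.

Fixpoint fixed_loops (X : seq nat) (c : cmd) : bool :=
  match c with
  | Sqc c1 c2 | Ite _ c1 c2 => fixed_loops X c1 && fixed_loops X c2
  | Rep (Var x) c => (x \in X) && fixed_loops X c
  | Rep _ _ => false
  | _ => true
  end.

(** No register of [X] is assigned, so all loop counts keep their initial values. This settles every
    loop of the program except the one over a level, whose count varies, and the outermost one
    around it. *)
Lemma fixed_cost X S c st :
    fixed_loops X c -> ~~ has [in mods c] X ->
    (forall x, x \in X -> regs st x <= S) ->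
  cost c st <= scost S c.
Proof.
elim: c st => [|y e|e1 e2|c1 IH1 c2 IH2|e c1 IH1 c2 IH2|e c IH] st //=.
- case/andP=> f1 f2 nm le_S; apply: leq_add.
    apply: IH1 => //; apply: contra nm => /hasP[x xX xm]; apply/hasP.
    by exists x; rewrite ?mem_cat ?[_ \in _]xm.
  apply: IH2 => //.
    apply: contra nm => /hasP[x xX xm]; apply/hasP.
    by exists x; rewrite ?mem_cat ?[_ \in mods c2]xm ?orbT.
  move=> x xX; rewrite den_frame ?le_S //; apply: contra nm => xm; apply/hasP.
  by exists x; rewrite ?mem_cat ?xm.
- case/andP=> f1 f2 nm le_S; rewrite leq_add2l ltnS.
  have l1 : cost c1 st <= scost S c1.
    apply: IH1 => //; apply: contra nm => /hasP[x xX xm]; apply/hasP.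
    by exists x; rewrite ?mem_cat ?[_ \in _]xm.
  have l2 : cost c2 st <= scost S c2.
    apply: IH2 => //; apply: contra nm => /hasP[x xX xm]; apply/hasP.
    by exists x; rewrite ?mem_cat ?[_ \in mods c2]xm ?orbT.
  by case: ifP => _; lia.
- case: e => // x /andP[xX f] nm le_S; rewrite leq_add2l ltnS /=.
  apply: leq_trans (_ : regs st x * (scost S c).+3 <= _); last first.
    by rewrite leq_mul2r le_S ?orbT.
  rewrite -[X in X * _]card_ord -sum_nat_const; apply: leq_sum => i _.
  rewrite !ltnS; apply: IH => // y yX.
  rewrite iter_den_frame ?le_S //; apply: contra nm => ym; apply/hasP.
  by exists y.
Qed.

Lemma cost_rep_le e c st B :
    (forall i, i < eval e st -> cost c (iter i (den c) st) <= B) ->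
  cost (Rep e c) st <= ecost e + (eval e st * B.+3).+1.
Proof.
move=> leB /=; rewrite leq_add2l ltnS.
rewrite -[X in X * _]card_ord -sum_nat_const; apply: leq_sum => i _.
by rewrite !ltnS leB.
Qed.

(** * Paths and feedback edge sets *)

Section PathsAndForests.
Variable V : finType.
Implicit Types (A B F : {set {set V}}) (c : seq V) (u v w : V) (e : {set V}).

Lemma set2_inj u v w : [set u; v] = [set u; w] -> v = w.
Proof.
move=> eq_vw; have := set22 u v; have := set22 u w.
by rewrite -eq_vw {2}eq_vw !inE => /orP[]/eqP-> /orP[]/eqP.
Qed.

Fixpoint pedges c : seq {set V} :=
  match c with
  | u :: (v :: _) as c' => [set u; v] :: pedges c'
  | _ => [::]
  end.

Lemma pedges_cons2 u v c :
  pedges [:: u, v & c] = [set u; v] :: pedges (v :: c).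
Proof. by []. Qed.

Lemma mem_pedges c e w : e \in pedges c -> w \in e -> w \in c.
Proof.
elim: c => [|u [|v c] IH] //=; rewrite inE => /orP[/eqP->|/IH sub_e /sub_e we].
  by rewrite !inE => /orP[]/eqP->; rewrite eqxx ?orbT.
by rewrite in_cons we orbT.
Qed.

Lemma pedges_uniq c : uniq c -> uniq (pedges c).
Proof.
elim: c => [|u [|v c] IH] //= /andP[nu Uc]; rewrite [X in _ && X]IH // andbT.
rewrite -/(pedges (v :: c)).
by apply: contra nu => /mem_pedges; apply; rewrite set21.
Qed.

(** An edge [[set u; v]] changes the parity at [u] and at [v]; along the path these changes
    telescope to the two ends. *)
Lemma odd_degree_path w u c :
  uniq (u :: c) ->
  odd (count (fun e => w \in e) (pedges (u :: c))) =
    (w == u) (+) (w == last u c).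
Proof.
elim: c u => [|v c IH] u; first by rewrite addbb.
move=> /= /andP[]; rewrite inE negb_or => /andP[neq_uv _] Uc.
rewrite oddD [X in _ (+) X]IH // addbA; congr (_ (+) _).
rewrite !inE; case: (w =P u) => [->|_]; last by case: eqP.
by rewrite (negPf neq_uv).
Qed.

Lemma sub_is_forest A B : B \subset A -> is_forest A -> is_forest B.
Proof.
move=> sBA /is_forestP fA; apply/is_forestP => c Uc c_gt2.
apply: contra (fA c Uc c_gt2); case: c {Uc c_gt2} => //= x c.
by apply: sub_path => u v /(subsetP sBA).
Qed.

(* In a graph with even degrees a path can be prolonged until it closes up. *)
Lemma even_forest B :
    is_forest B -> {in B, forall e, #|e| = 2} ->
    (forall w, ~~ odd #|[set e in B | w \in e]|) ->
  B = set0.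
Proof.
move=> /is_forestP fB B2 evenB.
(* A path can grow to at most [#|V|] vertices, hence the induction on the room left. *)
have extend u v c : uniq [:: u, v & c] -> path (adjacent B) u (v :: c) -> False.
  move: {-1}(#|V| - size c) (leqnn (#|V| - size c)) => n.
  elim: n u v c => [|n IH] u v c le_n Uc pc.
    move: le_n; rewrite leqn0 subn_eq0.
    move=> /(leq_trans (max_card [in [:: u, v & c]])).
    by rewrite (card_uniqP Uc) /= ltnNge leqnSn.
  have uvB : [set u; v] \in B by case/andP: pc.
  (* The degree of [u] is even and [[set u; v]] contributes to it, so a second edge leaves [u]. *)
  have [e]: exists e, e \in [set e in B | u \in e] :\ [set u; v].
    apply/set0Pn; apply: contra (evenB u) => /eqP eq0.
    by rewrite (cardsD1 [set u; v]) inE uvB set21 eq0 cards0.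
  rewrite !inE => /and3P[neq eB ue].
  have [w def_e neq_wu] : exists2 w, e = [set w; u] & w != u.
    have /cards2P[a [b [neq_ab def_e]]] : #|e| == 2 by rewrite B2.
    move: ue; rewrite def_e !inE => /orP[]/eqP->.
      by exists b; [rewrite setUC|rewrite eq_sym].
    by exists a.
  have adj_wu : adjacent B w u by move: eB; rewrite def_e.
  have neq_wv : w != v.
    by apply: contra neq => /eqP <-; rewrite def_e setUC.
  (* If [w] already lies on the path, the piece from [u] to [w] closes up to a cycle, and [w != v]
     gives it at least three vertices. *)
  have [wc|nwc] := boolP (w \in c); last first.
    apply: (IH w u (v :: c)); first by rewrite /= subnS -subn1 leq_subLR.
      by rewrite cons_uniq Uc andbT !inE !negb_or neq_wu neq_wv.
    by apply/andP.
  case/splitPr: wc Uc pc => c1 c2 {le_n} Uc pc.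
  have/negP[] : ~~ cycle (adjacent B) [:: u, v & rcons c1 w].
    apply: fB; last by rewrite /= size_rcons.
    by move: Uc; rewrite -cat_rcons -!cat_cons cat_uniq => /andP[].
  move: pc; rewrite -cat_rcons -!cat_cons cat_path => /andP[pc _].
  by rewrite /cycle rcons_path pc last_cons last_rcons.
apply/setP => e; rewrite inE; apply/negP => eB.
have /cards2P[a [b [neq_ab def_e]]] : #|e| == 2 by rewrite B2.
apply: (extend a b [::]); first by rewrite /= inE neq_ab.
by move: eB; rewrite def_e /= andbT.
Qed.

(** As [u] does not recur, only the first edge contains it. So the edge set reveals the second
    vertex, and deleting that edge on both sides allows induction. *)
Lemma pedges_inj u c1 c2 :
    uniq (u :: c1) -> uniq (u :: c2) -> pedges (u :: c1) =i pedges (u :: c2) ->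
  c1 = c2.
Proof.
elim: c1 u c2 => [|v c1 IH] u [|w c2] // U1 U2 eqE.
- by have := eqE [set u; w]; rewrite mem_head.
- by have := eqE [set u; v]; rewrite mem_head.
have [nu1 U1'] := andP U1; have [nu2 U2'] := andP U2.
have eq_vw : v = w.
  have := eqE [set u; v]; rewrite mem_head => /esym.
  rewrite pedges_cons2 inE => /orP[/eqP/set2_inj //|/mem_pedges/(_ (set21 _ _))].
  by rewrite (negPf nu2).
subst w; congr (_ :: _); apply: (IH v) => // e; have := eqE e.
rewrite !pedges_cons2 !in_cons.
have [->|//] := eqVneq e [set u; v]; move=> _.
have no c : u \notin v :: c -> [set u; v] \in pedges (v :: c) = false.
  by move=> nu; apply: contraNF nu => /mem_pedges; apply; rewrite set21.
by rewrite !no.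
Qed.

Definition static_path A c : bool := uniq c && all [in A] (pedges c).

(* Two paths with the same ends differ by a set of edges with even degrees,
   and that set lies in the forest [A :\: F]. *)
Lemma path_determined A F u c1 c2 :
    {in A, forall e, #|e| = 2} -> is_forest (A :\: F) ->
    static_path A (u :: c1) -> static_path A (u :: c2) ->
    last u c1 = last u c2 ->
    {in F, pedges (u :: c1) =i pedges (u :: c2)} ->
  c1 = c2.
Proof.
move=> A2 fA /andP[U1 /allP A1] /andP[U2 /allP A2'] eq_last eqF.
pose E1 := [set e in pedges (u :: c1)]; pose E2 := [set e in pedges (u :: c2)].
pose B := (E1 :\: E2) :|: (E2 :\: E1).
have sB : B \subset A :\: F.
  apply/subsetP=> e; rewrite !inE => Be; apply/andP; split.
    apply/negP => eF; move: Be; rewrite eqF //.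
    by case: (_ \in pedges _).
  by case/orP: Be => /andP[_] => [/A1|/A2'].
have deg w c : uniq (u :: c) ->
    odd #|[set e in [set e in pedges (u :: c)] | w \in e]| =
    (w == u) (+) (w == last u c).
  move=> Uc; rewrite -odd_degree_path // -size_filter.
  rewrite -(card_uniqP (filter_uniq _ (pedges_uniq Uc))).
  by congr (odd _); apply: eq_card => e; rewrite !inE mem_filter andbC.
have B0 : B = set0.
  apply: (even_forest (sub_is_forest sB fA)).
    by move=> e /(subsetP sB); rewrite inE => /andP[_ /A2].
  move=> w; pose D (E : {set {set V}}) := [set e in E | w \in e].
  have -> : [set e in B | w \in e] = (D E1 :\: D E2) :|: (D E2 :\: D E1).
    apply/setP => e; rewrite !inE.
    by case: (w \in e); rewrite ?andbT ?andbF.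
  have : odd #|D E1| = odd #|D E2| by rewrite !deg // eq_last.
  rewrite cardsU; set I := _ :&: _.
  have -> : I = set0.
    apply/setP => e; rewrite !inE.
    by case: (w \in e); case: (_ \in pedges _); case: (_ \in pedges _).
  rewrite cards0 subn0 oddD.
  (* The common edges count in both degrees and cancel modulo 2. *)
  rewrite -(cardsID (D E2) (D E1)) -(cardsID (D E1) (D E2)) setIC !oddD.
  by do 3! case: (odd _).
apply: (@pedges_inj u) => // e.
have := in_set0 e; rewrite -B0 !inE.
by case: (_ \in pedges _); case: (_ \in pedges _).
Qed.

(** Paths are stored backwards, so all of them end in [s] and the head is free. The head gives the
    factor [#|V|], the used edges of a minimum feedback edge set give the power of 2. *)
Lemma card_static_paths A (s : V) (C : seq (seq V)) :
    {in A, forall e, #|e| = 2} -> uniq C ->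
    {in C, forall c, [&& c != [::], last s c == s & static_path A c]} ->
  size C <= #|V| * 2 ^ feedback_edge_number A.
Proof.
move=> A2 UC paths; rewrite /feedback_edge_number.
case: arg_minnP => [|F]; first exact: feedback_edge_setT.
move=> /andP[sFA fA] _.
pose code c := (head s c, [set e in F | e \in pedges c]).
rewrite -(size_map code) -card_powerset -cardsT -cardsX.
have injC : {in C &, injective code}.
  move=> [|u c1] [|v c2] /paths/and3P[// _ /eqP l1 p1] /paths/and3P[// _ /eqP l2 p2].
  case=> eq_uv eqF; subst v; congr (_ :: _).
  apply: (path_determined A2 fA p1 p2).
    by rewrite -[LHS]/(last s (u :: c1)) l1 -l2.
  by move=> e eF; have /setP/(_ e) := eqF; rewrite !inE eF.
rewrite -(card_uniqP _) ?map_inj_in_uniq //; apply: subset_leq_card.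
apply/subsetP=> _ /mapP[c _ ->]; rewrite !inE /=.
by apply/subsetP => e; rewrite inE => /andP[].
Qed.

End PathsAndForests.

(** * Temporal paths along static paths *)

Lemma pairmap_rcons (X Y : Type) (f : X -> X -> Y) x s y :
  pairmap f x (rcons s y) = rcons (pairmap f x s) (f (last x s) y).
Proof. by elim: s x => //= z s IH x; rewrite IH. Qed.

Lemma sorted_rcons2 (X : Type) (r : rel X) s a b :
  sorted r (rcons (rcons s a) b) = sorted r (rcons s a) && r a b.
Proof. by case: s => [|x s] /=; rewrite ?andbT // !rcons_path last_rcons. Qed.

Lemma card_bseq (X : finType) n (P : pred (seq X)) (L : seq (seq X)) :
    uniq L -> L =i P -> (forall p, P p -> size p <= n) ->
  #|[set p : {bseq n of X} | P p]| = size L.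
Proof.
move=> UL memL le_n.
rewrite cardE -(size_map val); apply/perm_size/uniq_perm => //.
  by rewrite map_inj_uniq ?enum_uniq //; exact: val_inj.
move=> p; apply/mapP/idP => [[q] | /[!memL] Pp].
  by rewrite mem_enum inE => Pq ->; rewrite memL.
by exists (Bseq (le_n p Pp)); rewrite ?mem_enum ?inE.
Qed.

Section Labellings.
Variables (V : finType) (T : nat).
Local Notation time_edge := ({set V} * 'I_T)%type.
Variable tes : seq time_edge.
Hypothesis tes_uniq : uniq tes.

(* Paths are stored backwards, the current end first.  [labs c tau] lists,
   also backwards, the temporal paths along [c] ending no later than [tau]. *)
Fixpoint labs (c : seq V) (tau : nat) : seq (seq time_edge) :=
  match c with
  | u :: (v :: _) as c' =>
      [seq e :: q | e : time_edge <- [seq e : time_edge <- tes | (e.1 == [set v; u]) && (e.2 < tau)],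
                    q : seq time_edge <- labs c' e.2.+1]
  | _ => [:: [::]]
  end.

Definition nlabs c tau := size (labs c tau).

Lemma labs_cons2 u v r tau :
  labs [:: u, v & r] tau =
  [seq e :: q | e : time_edge <- [seq e : time_edge <- tes | (e.1 == [set v; u]) && (e.2 < tau)],
                q : seq time_edge <- labs (v :: r) e.2.+1].
Proof. by []. Qed.

(** The recurrence of the dynamic program, split by the last time-edge [e]. A label [t] stands for
    time [t.+1], so [e.2 < tau] means that [e] is no later than [tau], and [e.2.+1] is the deadline
    of the rest. *)
Lemma nlabs_cons2 u v r tau :
  nlabs [:: u, v & r] tau =
  \sum_(e <- tes | (e.1 == [set v; u]) && (e.2 < tau)) nlabs (v :: r) e.2.+1.
Proof.
by rewrite /nlabs labs_cons2 size_allpairs_dep sumnE big_map big_filter.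
Qed.

Lemma cons_mem_labs u v r tau e q :
  (e :: q \in labs [:: u, v & r] tau) =
  [&& e \in tes, e.1 == [set v; u], e.2 < tau & q \in labs (v :: r) e.2.+1].
Proof.
rewrite labs_cons2; apply/allpairsPdep/idP => [[e' [q' []]]|].
  by rewrite mem_filter => /andP[/andP[H1 H2] H3] H4 [-> ->]; apply/and4P.
case/and4P=> H3 H1 H2 H4; exists e, q; split=> //.
by rewrite mem_filter H1 H2.
Qed.

Lemma labs_uniq c tau : uniq (labs c tau).
Proof.
elim: c tau => [|u [|v r] IH] tau //; rewrite labs_cons2.
apply: allpairs_uniq_dep; first exact: filter_uniq.
  by move=> e _; exact: IH.
by move=> [e q] [e' q'] _ _ /= [-> ->].
Qed.

Lemma sub_labs c tau tau' :
  tau <= tau' -> {subset labs c tau <= labs c tau'}.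
Proof.
move=> le_tau; case: c => [|u [|v r]] // [|e q].
  by rewrite labs_cons2 => /allpairsPdep[? [? []]].
by rewrite !cons_mem_labs => /and4P[-> -> /leq_trans->].
Qed.

Lemma nlabs_gt0P c tau : reflect (exists q, q \in labs c tau) (0 < nlabs c tau).
Proof.
rewrite /nlabs -has_predT.
by apply: (iffP hasP) => [[q qL _]|[q qL]]; exists q.
Qed.

Lemma nlabs_gt0_mono c tau tau' :
  tau <= tau' -> 0 < nlabs c tau -> 0 < nlabs c tau'.
Proof.
by move=> le_tau /nlabs_gt0P[q qL]; apply/nlabs_gt0P; exists q;
  apply: sub_labs qL.
Qed.

(** Dropping the last time-edge leaves a temporal path along the shorter path. Hence discarding
    paths without temporal paths cuts off no useful descendant. *)
Lemma nlabs_gt0_behead u c tau tau' :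
  c != [::] -> tau <= tau' -> 0 < nlabs (u :: c) tau -> 0 < nlabs c tau'.
Proof.
case: c => // v r _ le_tau /nlabs_gt0P[[|e q]].
  by rewrite labs_cons2 => /allpairsPdep[? [? []]].
rewrite cons_mem_labs => /and4P[_ _ lt_e qL]; apply/nlabs_gt0P; exists q.
by apply: sub_labs qL; exact: leq_trans le_tau.
Qed.

(** Brings the kept paths under the bound for static paths without a test of the underlying
    graph. *)
Lemma nlabs_gt0_pedges c tau :
  0 < nlabs c tau -> all [in [seq e.1 | e <- tes]] (pedges c).
Proof.
elim: c tau => [|u [|v r] IH] tau // L_gt0.
have /nlabs_gt0P[[|e q]] := L_gt0.
  by rewrite labs_cons2 => /allpairsPdep[? [? []]].
rewrite cons_mem_labs => /and4P[eE /eqP def_e lt_e qL].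
rewrite pedges_cons2 [all _ _]/=; apply/andP; split.
  by rewrite setUC -def_e; apply: map_f.
by apply: (IH e.2.+1); apply/nlabs_gt0P; exists q.
Qed.

(** The bridge to the forward definition of temporal paths. Appending [tau] as a final time turns
    monotonicity and deadline into a single sortedness condition, which splits well when the last
    vertex is removed. *)
Lemma rev_mem_labs s vs p tau :
  (rev p \in labs (rev (s :: vs)) tau) =
  [&& all [in tes] p,
      [seq e.1 | e <- p] == pairmap (fun u v => [set u; v]) s vs &
      sorted leq (rcons [seq (val e.2).+1 | e <- p] tau)].
Proof.
elim/last_ind: vs p tau => [|vs u IH] p tau.
  case/lastP: p => [|p e] //=; rewrite rev_rcons inE /=.
  by case: p => [|? ?]; rewrite /= ?andbF.
have def_c : rev (s :: rcons vs u) = u :: rev (s :: vs).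
  by rewrite -rcons_cons rev_rcons.
have [r def_r] : exists r, rev (s :: vs) = last s vs :: r.
  by rewrite lastI rev_rcons; exists (rev (belast s vs)).
rewrite def_c def_r pairmap_rcons; case/lastP: p => [|p e].
  rewrite [in RHS]/= andbT; case: (pairmap _ _ _) => //= [|a l].
    by apply/negP => /allpairsPdep[? [? []]].
  by apply/negP => /allpairsPdep[? [? []]].
rewrite rev_rcons cons_mem_labs -def_r IH all_rcons !map_rcons eqseq_rcons.
by rewrite sorted_rcons2 -!andbA; do !bool_congr.
Qed.

(** With [s] fixed, a temporal path determines its vertices, so no temporal path is counted along
    two static paths. *)
Lemma pairmap_set2_inj (s : V) vs vs' :
  pairmap (fun u v => [set u; v]) s vs = pairmap (fun u v => [set u; v]) s vs' ->
  vs = vs'.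
Proof.
elim: vs vs' s => [|v vs IH] [|v' vs'] s //= [/set2_inj <- /IH-> //].
Qed.

End Labellings.

(** * Breadth-first levels of static paths *)

Section Levels.
Variables (V : finType) (T : nat).
Local Notation time_edge := ({set V} * 'I_T)%type.
Variable tes : seq time_edge.
Variables (us : seq V) (s : V).
Hypotheses (us_uniq : uniq us) (mem_us : forall u, u \in us).

Definition extends c u := uniq (u :: c) && (0 < nlabs tes (u :: c) T).

Definition extensions c := [seq u :: c | u <- us & extends c u].

Definition next_level (C : seq (seq V)) := flatten [seq extensions c | c <- C].

Definition level (l : nat) := iter l next_level [:: [:: s]].

(** Both conditions of [extends] pass to the list without its head, so the search reaches every list
    that satisfies them. *)
Lemma mem_level l c :
  (c \in level l) =
  [&& size c == l.+1, last s c == s, uniq c & 0 < nlabs tes c T].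
Proof.
elim: l c => [|l IH] c.
  rewrite inE; apply/eqP/idP => [->|]; first by rewrite /= eqxx.
  by case: c => [|u [|v c]] // /and4P[_ /eqP /= ->].
apply/flattenP/idP => [[_ /mapP[c' + ->] /mapP[u + ->]]|].
  rewrite IH mem_filter => /and4P[/eqP sz_c' /eqP last_c' _ _].
  move=> /andP[/andP[Uc L_gt0] _]; rewrite Uc L_gt0 /= sz_c' eqxx /= andbT.
  by case: c' last_c' sz_c' {Uc L_gt0} => //= a c' ->.
case: c => [|u c] // /and4P[/= /eqP[sz_c] /eqP last_c Uc L_gt0].
exists (extensions c).
  apply: map_f; rewrite IH sz_c eqxx /=; have [_ ->] := andP Uc.
  have nz_c : c != [::] by rewrite -size_eq0 sz_c.
  rewrite (nlabs_gt0_behead nz_c (leqnn T) L_gt0) !andbT.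
  by case: c last_c nz_c {sz_c Uc L_gt0} => //= a c ->.
by apply: map_f; rewrite mem_filter mem_us andbT; apply/andP.
Qed.

Lemma level_uniq l : uniq (level l).
Proof.
elim: l => [|l IH] //=; rewrite /next_level.
have -> : flatten [seq extensions c | c <- level l] =
    [seq u :: c | c <- level l, u <- [seq u <- us | extends c u]] by [].
apply: allpairs_uniq_dep => // [c _|[c u] [c' u'] _ _ /= [-> ->] //].
exact: filter_uniq.
Qed.

Lemma size_level l (A : {set {set V}}) :
    {in A, forall e : {set V}, #|e| = 2} -> A =i [seq e.1 | e <- tes] ->
  size (level l) <= #|V| * 2 ^ feedback_edge_number A.
Proof.
move=> A2 memA; apply: (@card_static_paths _ _ s) => //; first exact: level_uniq.
move=> c; rewrite mem_level => /and4P[/eqP sz_c -> Uc /nlabs_gt0_pedges Ec].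
rewrite /static_path Uc -size_eq0 sz_c /=; apply/allP => e /(allP Ec) eE.
by rewrite -memA in eE.
Qed.

End Levels.

(** * Counting temporal paths level by level *)

Section Count.
Variable G : temporal_graph.
Variables (tes : seq ({set vertex G} * 'I_(lifetime G))) (us : seq (vertex G)).
Hypothesis tesE : perm_eq tes (enum (time_edges G)).
Hypotheses (us_uniq : uniq us) (mem_us : forall u, u \in us).
Variables s z : vertex G.

Let tes_uniq : uniq tes.
Proof. by rewrite (perm_uniq tesE) enum_uniq. Qed.

Let mem_tes e : (e \in tes) = (e \in time_edges G).
Proof. by rewrite (perm_mem tesE) mem_enum. Qed.

Lemma num_temporal_pathsE :
  num_temporal_paths s z =
  \sum_(l < #|vertex G|) \sum_(c <- level tes us s l | head s c == z)
    nlabs tes c (lifetime G).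
Proof.
set n := #|_|; set T := lifetime G.
(* A simple path has at most [n] vertices, so the levels below [n] contain all candidates. *)
pose C := [seq c <- flatten [seq level tes us s l | l <- iota 0 n] | head s c == z].
have mem_C c : (c \in C) = [&& head s c == z, 0 < size c <= n, last s c == s,
    uniq c & 0 < nlabs tes c T].
  rewrite mem_filter; congr (_ && _); apply/flattenP/idP.
    move=> [_ /mapP[l + ->]]; rewrite mem_iota mem_level //.
    by move=> /= lt_ln /and4P[/eqP-> -> -> ->]; rewrite lt_ln.
  case/and4P=> /andP[c_gt0 le_cn] last_c Uc L_gt0.
  exists (level tes us s (size c).-1).
    by rewrite map_f // mem_iota prednK.
  by rewrite mem_level // prednK // eqxx last_c Uc.
have UC : uniq C.
  apply: filter_uniq.
  have -> : flatten [seq level tes us s l | l <- iota 0 n] =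
     [seq c | l <- iota 0 n, c <- level tes us s l].
    by congr flatten; apply: eq_map => l; rewrite map_id.
  apply: allpairs_uniq_dep => [|l _|].
  - exact: iota_uniq.
  - exact: level_uniq.
  (* Levels are disjoint, since the lists of level [l] have length [l.+1]. *)
  move=> [l c] [l' c'] /allpairsPdep[l1 [c1 [_ + ->]]].
  move=> + /allpairsPdep[l2 [c2 [_ + ->]]] /= eq_c; rewrite -{}eq_c !mem_level //.
  by case/and4P=> /eqP-> _ _ _ /and4P[/eqP[->] _ _ _].
pose P := [seq rev q | c <- C, q <- labs tes c T].
have rev_C c : c \in C -> exists2 vs, c = rev (s :: vs) & uniq (s :: vs) /\ last s vs = z.
  rewrite mem_C => /and5P[/eqP head_c /andP[c_gt0 _] /eqP last_c Uc _].
  case/lastP: c c_gt0 head_c last_c Uc => // c s' _ + /[!last_rcons] def_s.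
  move=> + Uc; subst s' => head_c; exists (rev c).
    by rewrite rev_cons revK.
  split; first by rewrite -rev_rcons rev_uniq.
  by rewrite -head_c; case: c {Uc head_c} => //= a c; rewrite rev_cons last_rcons.
have -> : num_temporal_paths s z = size P.
  apply: card_bseq => [|p|p /size_temporal_path/ltnW //].
    apply: allpairs_uniq_dep => // [c _|]; first exact: labs_uniq.
    move=> [c q] [c' q'] /allpairsPdep[c1 [q1 [c1C q1L [-> ->]]]].
    move=> /allpairsPdep[c2 [q2 [c2C q2L [-> ->]]]] /= /(can_inj revK) eq_q.
    subst q2; move: q1L q2L.
    have [vs1 -> _] := rev_C _ c1C; have [vs2 -> _] := rev_C _ c2C.
    rewrite -(revK q1) !rev_mem_labs => /and3P[_ /eqP-> _] /and3P[_ /eqP + _].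
    by move=> /pairmap_set2_inj->.
  apply/allpairsPdep/existsP => [[c [q [cC qL def_p]]]|[vs /and5P[pE eq_p]]].
    have [vs def_c [Uvs last_vs]] := rev_C _ cC.
    move: qL; rewrite def_c -(revK q) -def_p rev_mem_labs.
    case/and3P=> pE eq_p sp.
    have sz_vs : size vs == size p.
      by rewrite -(size_map fst p) (eqP eq_p) size_pairmap.
    exists (Tuple sz_vs); apply/and5P; split=> //=.
    - by rewrite -(eq_all mem_tes).
    - by rewrite last_vs.
    move: sp; case: (p) => //= e p'; rewrite rcons_path => /andP[+ _].
    by elim: p' e => [|e2 p2 IHp] e1 //= /andP[le_e /IHp->]; rewrite andbT.
  move=> /eqP last_vs Uvs sp.
  (* The deadline [T] is met automatically, as every label is below [T]. *)
  have pL : rev p \in labs tes (rev (s :: vs)) T.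
    rewrite rev_mem_labs eq_p (eq_all mem_tes) pE /=.
    case: (p) sp => //= e p'.
    elim: p' e => [|e2 p2 IHp] e1 /=; first by rewrite ltn_ord.
    by case/andP=> le_e /IHp; rewrite ltnS le_e.
  exists (rev (s :: vs)), (rev p); split; rewrite ?revK //.
  rewrite mem_C size_rev rev_uniq Uvs /= -last_vs.
  have -> : head s (rev (s :: vs)) = last s vs.
    by rewrite lastI rev_rcons.
  rewrite eqxx /= rev_cons last_rcons eqxx /=; apply/andP; split; last first.
    by apply/nlabs_gt0P; exists (rev p); rewrite -rev_cons.
  by rewrite -[(size vs).+1]/(size (s :: vs)) -(card_uniqP Uvs) max_card.
rewrite size_allpairs_dep sumnE big_map big_filter big_flatten /=.
by rewrite big_map -[n in iota _ n]subn0 -/(index_iota 0 n) big_mkord.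
Qed.

End Count.

Lemma eq_set2 (V : finType) (a b c d : V) : a != b ->
  ([set a; b] == [set c; d]) =
  ((a == c) && (b == d)) || ((a == d) && (b == c)).
Proof.
move=> neq_ab; apply/eqP/idP => [eq_ab|]; last first.
  by case/orP=> /andP[/eqP-> /eqP->]; rewrite // setUC.
have := set21 a b; have := set22 a b; rewrite eq_ab !inE.
case/orP=> /eqP def_b /orP[]/eqP def_a; subst a b; rewrite ?eqxx ?orbT //.
- by rewrite eqxx in neq_ab.
- by rewrite eqxx in neq_ab.
Qed.

(** * The recurrence for tables *)

Section Table.
Variables (V : finType) (T N : nat) (name : V -> nat).
Variable es : seq (V * V * 'I_T).
Hypotheses (name_inj : injective name) (name_lt : forall v, name v < N).
Hypothesis es_loopless : {in es, forall e, e.1.1 != e.1.2}.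

Definition unordered (e : V * V * 'I_T) : {set V} * 'I_T :=
  ([set e.1.1; e.1.2], e.2).

Local Notation tes := (map unordered es).

(* Beyond [es] there is a sentinel without real end points, at the last time;
   the table edge_entry of the sentinel counts all temporal paths. *)
Definition edge_entry (j : nat) : nat * nat * nat :=
  nth (N, N, T) [seq (name e.1.1, name e.1.2, (val e.2).+1) | e <- es] j.

Definition touches (e : nat * nat * nat) (v : V) : bool :=
  (e.1.1 == name v) || (e.1.2 == name v).

Definition joins (e : nat * nat * nat) (v u : V) : bool :=
  ((e.1.1 == name v) && (e.1.2 == name u)) ||
  ((e.1.1 == name u) && (e.1.2 == name v)).

Arguments touches : simpl never.
Arguments joins : simpl never.

(* Number of temporal paths along [c] that time-edge [j] may continue in time.
   Keeping 0 for time-edges that meet an inner vertex of [c] makes a separate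
   record of the visited vertices superfluous. *)
Definition path_table (c : seq V) (j : nat) : nat :=
  if uniq c && ~~ has (touches (edge_entry j)) (behead c)
  then nlabs tes c (edge_entry j).2 else 0.

Lemma entry_sentinel : edge_entry (size es) = (N, N, T).
Proof. by rewrite /edge_entry nth_default // size_map. Qed.

Lemma sentinel_touches v : touches (N, N, T) v = false.
Proof. by rewrite /touches /=; have := name_lt v; lia. Qed.

Lemma table_sentinel c :
  path_table c (size es) = if uniq c then nlabs tes c T else 0.
Proof.
rewrite /path_table entry_sentinel (_ : has _ _ = false) ?andbT //.
by apply/hasP => -[v _]; rewrite sentinel_touches.
Qed.

Definition name_edge (e : V * V * 'I_T) := (name e.1.1, name e.1.2, (val e.2).+1).

Lemma touches_edge e v : touches (name_edge e) v = (v == e.1.1) || (v == e.1.2).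
Proof. by rewrite /touches !(inj_eq name_inj) ![v == _]eq_sym. Qed.

Lemma joins_edge e v u : e \in es ->
  joins (name_edge e) v u = ([set e.1.1; e.1.2] == [set v; u]).
Proof.
by move=> /es_loopless ne; rewrite /joins !(inj_eq name_inj) eq_set2.
Qed.

(** The sentinel joins no two vertices, so including its position in the sum is harmless. Entries
    hold the time [(val e.2).+1], which turns [<=] into [<]. *)
Lemma sum_entries v u tau (F : nat * nat * nat -> nat) :
  \sum_(i < (size es).+1 | joins (edge_entry i) v u && ((edge_entry i).2 <= tau))
     F (edge_entry i) =
  \sum_(e <- es | joins (name_edge e) v u && (e.2 < tau)) F (name_edge e).
Proof.
rewrite big_mkcond big_ord_recr /= entry_sentinel.
have -> : joins (N, N, T) v u = false.
  by rewrite /joins /=; have := name_lt v; have := name_lt u; lia.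
rewrite addn0 -big_mkcond /=.
rewrite -(big_map name_edge (fun e => joins e v u && (e.2 <= tau)) F).
by rewrite (big_nth (N, N, T)) size_map big_mkord.
Qed.

(** Simplicity needs no test. If [u] lies in [r], every time-edge joining [v] and [u] meets [r], so
    its cell for [v :: r] is 0; if [u] is [v], no time-edge joins them. Likewise, a time-edge [j]
    that meets [r] has a zero cell already, so only contact with [v] has to be tested. *)
Lemma table_rec u v r j :
  path_table [:: u, v & r] j =
  if (0 < path_table (v :: r) j) && ~~ touches (edge_entry j) v then
    \sum_(i < (size es).+1 | joins (edge_entry i) v u && ((edge_entry i).2 <= (edge_entry j).2))
       path_table (v :: r) i
  else 0.
Proof.
pose D c e := if uniq c && ~~ has (touches e) (behead c) then nlabs tes c e.2 else 0.
have -> : path_table [:: u, v & r] j = D [:: u, v & r] (edge_entry j) by [].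
under eq_bigr do rewrite -/(D _ (edge_entry _)).
rewrite (sum_entries v u _ (D (v :: r))).
have [Uc|nUc] := boolP (uniq (v :: r)); last first.
  by rewrite /path_table /D cons_uniq (negPf nUc) andbF.
have [vj|nvj] := boolP (touches (edge_entry j) v).
  by rewrite /D /= vj andbF /= andbF.
rewrite andbT; have [rj|nrj] := boolP (has (touches (edge_entry j)) r).
  by rewrite /path_table /D /= rj orbT !andbF.
have [uc|nuc] := boolP (u \in v :: r).
  rewrite {1}/D cons_uniq uc /=; case: ifP => // _.
  apply/esym; rewrite big_seq_cond big1 // => e /and3P[eE].
  rewrite joins_edge // => /eqP def_e _; rewrite /D /= andbC.
  case: ifP => // /andP[/hasPn nt _].
  move: uc; rewrite inE => /orP[/eqP eq_uv|/nt].
    have := es_loopless eE.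
    have := set21 e.1.1 e.1.2; have := set22 e.1.1 e.1.2.
    by rewrite def_e eq_uv !inE !orbb => /eqP-> /eqP->; rewrite eqxx.
  by rewrite touches_edge -in_set2 def_e set22.
have defD : D [:: u, v & r] (edge_entry j) = nlabs tes [:: u, v & r] (edge_entry j).2.
  by rewrite /D cons_uniq nuc Uc /= (negPf nvj) (negPf nrj).
have defT : path_table (v :: r) j = nlabs tes (v :: r) (edge_entry j).2.
  by rewrite /path_table Uc /= nrj.
rewrite defD defT nlabs_cons2 big_map /=.
have eqJ e : e \in es ->
    ([set e.1.1; e.1.2] == [set v; u]) && (e.2 < (edge_entry j).2) =
    joins (name_edge e) v u && (e.2 < (edge_entry j).2).
  by move=> eE; rewrite joins_edge.
(* A cell that is 0 for want of early temporal paths along [v :: r] stays 0: each summand has an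
   even earlier or equal deadline. *)
case: posnP => [L0|_].
  rewrite big1 // => e /andP[_ lt_e]; apply/eqP; rewrite -leqn0 leqNgt.
  by apply/negP => /(nlabs_gt0_mono lt_e); rewrite L0.
rewrite big_seq_cond [RHS]big_seq_cond; apply: eq_big => [e|e].
  by case: (boolP (e \in es)) => //= /eqJ.
move=> /and3P[eE /eqP def_e lt_e]; rewrite /D Uc /=.
rewrite (_ : has _ _ = false) //; apply/hasP => -[w wr].
rewrite touches_edge -in_set2 def_e !inE => /orP[]/eqP eq_w; subst w.
  by rewrite cons_uniq wr in Uc.
by rewrite inE wr orbT in nuc.
Qed.

End Table.

(** * The counting program *)

(* The records of a queue lie between the addresses [rH] and [rT].  The record
   of a path consists of its end point and of its table.  The time-edges are
   listed as triples from address [rE] on; [rPJ] and [rPI] walk through them,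
   while [rHJ], [rTJ] and [rHI] are the matching positions in tables. *)
Local Notation rAns := 0 (only parsing).
Local Notation rN := 1 (only parsing).
Local Notation rM := 2 (only parsing).
Local Notation rE := 3 (only parsing).
Local Notation rZ := 4 (only parsing).
Local Notation rH := 5 (only parsing).
Local Notation rT := 6 (only parsing).
Local Notation rPend := 7 (only parsing).
Local Notation rV := 8 (only parsing).
Local Notation rU := 9 (only parsing).
Local Notation rPJ := 10 (only parsing).
Local Notation rHJ := 11 (only parsing).
Local Notation rTJ := 12 (only parsing).
Local Notation rPI := 13 (only parsing).
Local Notation rHI := 14 (only parsing).
Local Notation rAcc := 15 (only parsing).
Local Notation rCnt := 16 (only parsing).

(** Zero encodes truth: truncated subtraction tests [<=], [Dist] tests equality, a sum is a
    conjunction, and [Min] is a disjunction. *)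
Definition Dist (e1 e2 : expr) : expr := Plus (Minus e1 e2) (Minus e2 e1).
Definition Min (e1 e2 : expr) : expr := Minus e1 (Minus e1 e2).
Definition Incr (x a : nat) : cmd := Asg x (Plus (Var x) (Cst a)).

Definition sum_step : cmd :=
  let a := Mem (Var rPI) in
  let b := Mem (Plus (Var rPI) (Cst 1)) in
  let joined := Min (Plus (Dist a (Var rV)) (Dist b (Var rU)))
                    (Plus (Dist a (Var rU)) (Dist b (Var rV))) in
  let late := Minus (Mem (Plus (Var rPI) (Cst 2)))
                    (Mem (Plus (Var rPJ) (Cst 2))) in
  Sqc (Ite (Plus joined late) Skip
           (Asg rAcc (Plus (Var rAcc) (Mem (Var rHI)))))
      (Sqc (Incr rPI 3) (Incr rHI 1)).

Definition sum_entries_cmd : cmd :=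
  Sqc (Asg rAcc (Cst 0))
  (Ite (Mem (Var rHJ))
    (Ite (Dist (Mem (Var rPJ)) (Var rV))
      (Ite (Dist (Mem (Plus (Var rPJ) (Cst 1))) (Var rV))
        (Sqc (Asg rPI (Var rE))
        (Sqc (Asg rHI (Plus (Var rH) (Cst 1)))
             (Rep (Var rM) sum_step)))
        Skip) Skip) Skip).

Definition table_step : cmd :=
  Sqc sum_entries_cmd
  (Sqc (Sto (Var rTJ) (Var rAcc))
  (Sqc (Incr rPJ 3) (Sqc (Incr rHJ 1) (Incr rTJ 1)))).

Definition table_cmd : cmd :=
  Sqc (Sto (Var rT) (Var rU))
  (Sqc (Asg rPJ (Var rE))
  (Sqc (Asg rHJ (Plus (Var rH) (Cst 1)))
  (Sqc (Asg rTJ (Plus (Var rT) (Cst 1)))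
       (Rep (Var rM) table_step)))).

(** The new record is written at the tail on trial; unless its sentinel cell is positive, [rT] stays
    put and the next attempt overwrites it. *)
Definition extend_step : cmd :=
  Sqc table_cmd
  (Sqc (Ite (Mem (Plus (Var rT) (Var rM)))
         (Sqc (Asg rT (Plus (Plus (Var rT) (Var rM)) (Cst 1))) (Incr rPend 1))
         Skip)
       (Incr rU 1)).

Definition process : cmd :=
  Sqc (Asg rV (Mem (Var rH)))
  (Sqc (Ite (Dist (Var rV) (Var rZ)) Skip
         (Asg rAns (Plus (Var rAns) (Mem (Plus (Var rH) (Var rM))))))
  (Sqc (Asg rU (Cst 0))
  (Sqc (Rep (Var rN) extend_step)
       (Asg rH (Plus (Plus (Var rH) (Var rM)) (Cst 1)))))).

(** Saving the number of pending records before the loop separates one level from the next, which is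
    being appended meanwhile. *)
Definition level_step : cmd :=
  Sqc (Asg rCnt (Var rPend))
  (Sqc (Asg rPend (Cst 0)) (Rep (Var rCnt) process)).

Arguments iter : simpl never.
Arguments sum_step : simpl never.
Arguments sum_entries_cmd : simpl never.
Arguments table_step : simpl never.
Arguments table_cmd : simpl never.
Arguments extend_step : simpl never.
Arguments process : simpl never.
Arguments level_step : simpl never.

Lemma join_test a b v u t t' :
  let x := (a - v + (v - a)) + (b - u + (u - b)) in
  let y := (a - u + (u - a)) + (b - v + (v - b)) in
  (0 < x - (x - y) + (t - t')) =
  ~~ ([|| (a == v) && (b == u) | (a == u) && (b == v)] && (t <= t')).
Proof.
move=> x y; have x0 : (a == v) && (b == u) = (x == 0) by rewrite /x; lia.
have y0 : (a == u) && (b == v) = (y == 0) by rewrite /y; lia.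
by rewrite x0 y0; move: x y {x0 y0} => x y; lia.
Qed.

Lemma den_sqc c1 c2 st : den (Sqc c1 c2) st = den c2 (den c1 st).
Proof. by []. Qed.

Lemma iter0 (X : Type) (f : X -> X) x : iter 0 f x = x.
Proof. by []. Qed.

(** Along the one-vertex path there is just the empty temporal path, for every deadline, so all
    cells are 1. *)
Definition init_table : cmd :=
  Rep (Var rM) (Sqc (Sto (Var rT) (Cst 1)) (Incr rT 1)).

(** The triples stay where the input has them, behind five header cells and the [N] vertex names,
    and the sentinel triple is appended right after the input. Register 0 holds the input length
    until it is cleared for the answer. *)
Definition setup : cmd :=
  Sqc (Asg rN (Mem (Cst 0)))
  (Sqc (Asg rM (Plus (Mem (Cst 2)) (Cst 1)))
  (Sqc (Asg rE (Plus (Var rN) (Cst 5)))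
  (Sqc (Asg rZ (Mem (Cst 4)))
  (Sqc (Asg rH (Plus (Var 0) (Cst 3)))
  (Sqc (Sto (Var 0) (Var rN))
  (Sqc (Sto (Plus (Var 0) (Cst 1)) (Var rN))
  (Sqc (Sto (Plus (Var 0) (Cst 2)) (Mem (Cst 1)))
  (Sqc (Sto (Var rH) (Mem (Cst 3)))
  (Sqc (Asg rT (Plus (Var rH) (Cst 1)))
  (Sqc (Asg rPend (Cst 1)) (Asg rAns (Cst 0)))))))))))).

Definition count_cmd : cmd :=
  Sqc setup (Sqc init_table (Rep (Var rN) level_step)).

Arguments init_table : simpl never.
Arguments setup : simpl never.

Lemma size_flatten3 (A B : Type) (f g h : A -> B) (l : seq A) :
  size (flatten [seq [:: f e; g e; h e] | e <- l]) = 3 * size l.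
Proof. by elim: l => //= e l ->; rewrite mulnS. Qed.

Lemma nth_flatten3 (A B : Type) (b : B) (f g h : A -> B) (l : seq A) j i :
    i < 3 ->
  nth b (flatten [seq [:: f e; g e; h e] | e <- l]) (3 * j + i) =
  nth b (nth [::] [seq [:: f e; g e; h e] | e <- l] j) i.
Proof.
move=> lti; elim: l j => [|e l IH] [|j]; rewrite ?[flatten [::]]/= ?nth_nil //.
  by rewrite muln0 add0n; case: i lti {IH} => [|[|[|]]].
by rewrite mulnS -addnA; exact: IH.
Qed.

Lemma init_table_spec st n
    (st' := iter n (den (Sqc (Sto (Var rT) (Cst 1)) (Incr rT 1))) st) :
  [/\ forall a, a < regs st rT -> mem st' a = mem st a,
      forall j, j < n -> mem st' (regs st rT + j) = 1 &
      regs st' rT = regs st rT + n].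
Proof.
rewrite {}/st'; elim: n => [|n [m1 t1 T1]]; first by rewrite iter0 addn0.
rewrite iterS; move: (iter _ _ _) m1 t1 T1 => st1 m1 t1 T1.
rewrite /= /upd /= T1; split; last by rewrite addn1 addnS.
  by move=> a lta; case: eqP => [?|_]; [lia|exact: m1].
by move=> j ltj; case: eqP => // ?; apply: t1; lia.
Qed.

(** * Correctness and cost of the program *)

Section Program.
Variables (V : finType) (T : nat) (name : V -> nat).
Variable es : seq (V * V * 'I_T).
Local Notation N := #|V|.
Hypotheses (name_inj : injective name) (name_lt : forall v, name v < N).
Hypothesis es_loopless : {in es, forall e, e.1.1 != e.1.2}.
Variable us : seq V.
Hypothesis name_us : map name us = iota 0 N.
Variables s z : V.

Local Notation M1 := (size es).+1.
Local Notation R := M1.+1.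
Local Notation tes := (map (@unordered V T) es).
Local Notation entry := (edge_entry N name es).
Local Notation table := (path_table N name es).
Local Notation extensions := (extensions tes us).

Definition edges_at (m : nat -> nat) (p : nat) : Prop :=
  forall j, j < M1 ->
    [/\ m (p + 3 * j) = (entry j).1.1, m (p + 3 * j + 1) = (entry j).1.2
      & m (p + 3 * j + 2) = (entry j).2].

Definition table_at (m : nat -> nat) (p : nat) (c : seq V) : Prop :=
  forall j, j < M1 -> m (p + j) = table c j.

Definition record_at (m : nat -> nat) (p : nat) (c : seq V) : Prop :=
  m p = name (head s c) /\ table_at m (p + 1) c.

Definition records_at (m : nat -> nat) (p : nat) (L : seq (seq V)) : Prop :=
  forall q, q < size L -> record_at m (p + q * R) (nth [::] L q).

(** The last clause keeps the time-edges below the queue, out of reach of the writes at its tail. *)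
Definition context (st : state) : Prop :=
  [/\ regs st rN = N, regs st rM = M1, regs st rZ = name z,
      edges_at (mem st) (regs st rE) & regs st rE + 3 * M1 <= regs st rH].

Definition queue (st : state) (L : seq (seq V)) : Prop :=
  regs st rT = regs st rH + size L * R /\
  records_at (mem st) (regs st rH) L.

Lemma edges_below m m' p q :
  (forall a, a < q -> m' a = m a) -> p + 3 * M1 <= q ->
  edges_at m p -> edges_at m' p.
Proof.
move=> eq_m le_q edges j ltj; have [e1 e2 e3] := edges j ltj.
by rewrite !eq_m //; lia.
Qed.

Lemma records_below m m' p q L :
  (forall a, a < q -> m' a = m a) -> p + size L * R <= q ->
  records_at m p L -> records_at m' p L.
Proof.
move=> eq_m le_q recs i lti; have [e1 e2] := recs i lti.
have le_i : i.+1 * R <= size L * R by rewrite leq_mul2r lti orbT.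
split; first by rewrite eq_m //; lia.
by move=> j ltj; rewrite eq_m ?e2 //; lia.
Qed.

Lemma sum_loop st c v u j h n :
    edges_at (mem st) (regs st rE) -> table_at (mem st) (h + 1) c ->
    regs st rPI = regs st rE -> regs st rHI = h + 1 -> regs st rAcc = 0 ->
    regs st rV = name v -> regs st rU = name u ->
    regs st rPJ = regs st rE + 3 * j -> j < M1 -> n <= M1 ->
  let st' := iter n (den sum_step) st in
  [/\ mem st' = mem st, regs st' rPI = regs st rE + 3 * n,
      regs st' rHI = h + 1 + n &
      regs st' rAcc =
        \sum_(i < n | joins name (entry i) v u && ((entry i).2 <= (entry j).2))
          table c i].
Proof.
move=> edges tab PI0 HI0 Acc0 Vv Uu PJj ltj; cbv zeta.
elim: n => [|n IHn] le_n; first by rewrite big_ord0 muln0 !addn0.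
have [] := IHn (ltnW le_n); move: (@iter_den_frame sum_step n st).
rewrite iterS; set s1 := iter _ _ _ => frame m1 PI1 HI1 Acc1.
rewrite big_mkcond big_ord_recr -big_mkcond -{}Acc1.
have V1 : regs s1 rV = name v by rewrite frame.
have U1 : regs s1 rU = name u by rewrite frame.
have PJ1 : regs s1 rPJ = regs st rE + 3 * j by rewrite frame.
have [a1 b1 t1] := edges n le_n; have [_ _ tj] := edges j ltj.
have tabn := tab n le_n.
rewrite /sum_step /= V1 U1 PJ1 PI1 HI1 m1 a1 b1 t1 tj /joins.
rewrite join_test if_neg; case: ifP => /= _;
  rewrite /= /upd /= ?PI1 ?HI1 ?m1 ?tabn ?addn0; split=> //; lia.
Qed.

Lemma sum_entries_spec st v r u j :
    edges_at (mem st) (regs st rE) ->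
    table_at (mem st) (regs st rH + 1) (v :: r) -> regs st rM = M1 ->
    regs st rV = name v -> regs st rU = name u ->
    regs st rPJ = regs st rE + 3 * j -> regs st rHJ = regs st rH + 1 + j ->
    j < M1 ->
  mem (den sum_entries_cmd st) = mem st /\
  regs (den sum_entries_cmd st) rAcc = table [:: u, v & r] j.
Proof.
move=> edges tab Mm Vv Uu PJj HJj ltj; rewrite table_rec //.
have [aj bj _] := edges j ltj; have tabj := tab j ltj.
rewrite /sum_entries_cmd /= /upd /= HJj PJj Vv tabj aj bj.
case: posnP => [//|_]; rewrite /touches negb_or.
have dist0 a b : (0 < a - b + (b - a)) = (a != b) by lia.
rewrite !dist0; case: (_ != _) => //; case: (_ != _) => //=.
set st1 := set_reg _ _ _; rewrite Mm.
by have [||||||||||-> _ _ ->] := @sum_loop st1 (v :: r) v u j (regs st rH) M1.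
Qed.

Lemma table_loop st v r u n :
    edges_at (mem st) (regs st rE) -> regs st rE + 3 * M1 <= regs st rH ->
    table_at (mem st) (regs st rH + 1) (v :: r) -> regs st rM = M1 ->
    regs st rV = name v -> regs st rU = name u ->
    regs st rH + R <= regs st rT ->
    regs st rPJ = regs st rE -> regs st rHJ = regs st rH + 1 ->
    regs st rTJ = regs st rT + 1 -> n <= M1 ->
  let st' := iter n (den table_step) st in
  [/\ forall a, a <= regs st rT -> mem st' a = mem st a,
      forall j, j < n -> mem st' (regs st rT + 1 + j) = table [:: u, v & r] j,
      regs st' rPJ = regs st rE + 3 * n,
      regs st' rHJ = regs st rH + 1 + n &
      regs st' rTJ = regs st rT + 1 + n].
Proof.
move=> edges leE tab Mm Vv Uu leT PJ0 HJ0 TJ0; cbv zeta.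
elim: n => [|n IHn] le_n; first by split=> //; rewrite ?muln0 ?addn0.
have [] := IHn (ltnW le_n).
move: (@iter_den_frame table_step n st).
rewrite iterS; set s1 := iter _ _ _ => frame m1 tab1 PJ1 HJ1 TJ1.
have E1 : regs s1 rE = regs st rE by rewrite frame.
have H1 : regs s1 rH = regs st rH by rewrite frame.
have [||||||||m2 Acc2] := @sum_entries_spec s1 v r u n;
  rewrite ?E1 ?H1 //; try by rewrite frame.
- by apply: (@edges_below _ _ _ (regs st rT)) edges => [a lta|]; [apply: m1|]; lia.
- by move=> j ltj; rewrite m1 ?tab //; lia.
have frame2 x : x \notin mods sum_entries_cmd ->
    regs (den sum_entries_cmd s1) x = regs s1 x by exact: den_frame.
rewrite /table_step /= /upd /= Acc2 m2 !frame2 // PJ1 HJ1 TJ1.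
split; [| |lia|lia|lia] => [a lea|j ltj].
  by case: eqP => [?|_]; [lia|exact: m1].
have [->|neq] := eqVneq j n; first by rewrite eqxx.
by case: eqP => [?|_]; [lia|apply: tab1; lia].
Qed.

Lemma table_spec st v r u :
    context st -> record_at (mem st) (regs st rH) (v :: r) ->
    regs st rV = name v -> regs st rU = name u ->
    regs st rH + R <= regs st rT ->
  (forall a, a < regs st rT -> mem (den table_cmd st) a = mem st a) /\
  record_at (mem (den table_cmd st)) (regs st rT) [:: u, v & r].
Proof.
move=> [Nn Mm _ edges leE] [_ tab] Vv Uu leT.
rewrite /table_cmd /= /upd /= Mm; set st1 := set_reg _ _ _.
have low a : a < regs st rT -> mem st1 a = mem st a.
  by move=> lta; rewrite /= /upd; case: eqP => // ?; lia.
have H1 : regs st1 rH = regs st rH by [].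
have T1 : regs st1 rT = regs st rT by [].
have E1 : regs st1 rE = regs st rE by [].
have [|||||||||||m2 tab2 _ _ _] := @table_loop st1 v r u M1.
- rewrite E1; apply: (@edges_below _ _ _ (regs st rT)) edges; first exact: low.
  by lia.
- by rewrite E1 H1.
- by rewrite H1 => j ltj; rewrite low ?tab //; lia.
- exact: Mm.
- exact: Vv.
- exact: Uu.
- by rewrite H1 T1.
- by [].
- by [].
- by [].
- by [].
rewrite T1 in m2 tab2; move: m2 tab2; set m' := mem _ => m2 tab2.
split; last split.
- by move=> a lta; rewrite m2 ?low // ltnW.
- by rewrite m2 // /= /upd eqxx Uu.
- by move=> j ltj; rewrite tab2.
Qed.

Lemma context_low st st' :
    context st -> regs st rH <= regs st rT -> regs st rH <= regs st' rH ->
    (forall x, x \in [:: rN; rM; rE; rZ] -> regs st' x = regs st x) ->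
    (forall a, a < regs st rT -> mem st' a = mem st a) ->
  context st'.
Proof.
move=> [Nn Mm Zz edges leE] leT leH eq_r eq_m; split; rewrite ?(eq_r rN) ?(eq_r rM) ?(eq_r rE) ?(eq_r rZ) //.
  by apply: (@edges_below _ _ _ (regs st rT)) edges => //; lia.
exact: leq_trans leE leH.
Qed.

(** No vertex touches the sentinel, so its cell is positive exactly when both tests of [extends]
    succeed. *)
Lemma extends_table c u : extends tes c u = (0 < table (u :: c) (size es)).
Proof. by rewrite table_sentinel // /extends; case: ifP. Qed.

Lemma extend_spec st v r L u :
    context st -> queue st ((v :: r) :: L) ->
    regs st rV = name v -> regs st rU = name u ->
  let st' := den extend_step st in
  [/\ context st', regs st' rH = regs st rH, regs st' rU = (name u).+1,
      queue st' ((v :: r) ::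
        if extends tes (v :: r) u then rcons L [:: u, v & r] else L) &
      regs st' rPend = regs st rPend + extends tes (v :: r) u].
Proof.
move=> ctx [defT recs] Vv Uu; cbv zeta.
have le_HT : regs st rH + R <= regs st rT by rewrite defT /= mulSn; lia.
have [Nn Mm Zz edges leE] := ctx.
have rec0 : record_at (mem st) (regs st rH) (v :: r).
  by have := recs 0 isT; rewrite mul0n addn0.
have [] := table_spec ctx rec0 Vv Uu le_HT.
move: (@den_frame table_cmd st); rewrite /extend_step den_sqc.
move: (den table_cmd st) => st1 frame low new.
have M1' : regs st1 rM = M1 by rewrite frame.
have T1 : regs st1 rT = regs st rT by rewrite frame.
have H1 : regs st1 rH = regs st rH by rewrite frame.
have U1 : regs st1 rU = name u by rewrite frame.
have P1 : regs st1 rPend = regs st rPend by rewrite frame.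
have ctx1 : context st1.
  apply: context_low ctx _ _ _ low; rewrite ?H1 //; first by lia.
  by move=> x; rewrite !inE => /or4P[]/eqP->; rewrite frame.
have recs1 : records_at (mem st1) (regs st rH) ((v :: r) :: L).
  by apply: (@records_below _ _ _ (regs st rT)) recs => //; rewrite defT.
have cell : mem st1 (regs st1 rT + regs st1 rM) =
    table [:: u, v & r] (size es).
  by rewrite T1 M1' -new.2 //; congr (mem _ _); lia.
rewrite /= cell -extends_table; case: ifP => _; last first.
  by rewrite /set_reg /queue /= /upd /= U1 P1 H1 T1 addn0 addn1.
rewrite /set_reg /queue /= /upd /= U1 P1 H1 T1 M1' !addn1.
split=> //; split; first by rewrite size_rcons defT /= !mulSn; lia.
move=> q; rewrite -rcons_cons size_rcons ltnS leq_eqVlt nth_rcons.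
case/orP=> [/eqP->|ltq]; last by rewrite ltq; exact: recs1.
by rewrite ltnn eqxx -defT.
Qed.

(** By [name_us], [us] is ordered by names, so the counter [rU] runs through [us]. *)
Lemma extend_loop st v r L n :
    context st -> queue st ((v :: r) :: L) ->
    regs st rV = name v -> regs st rU = 0 -> n <= N ->
  let st' := iter n (den extend_step) st in
  let ext := [seq u :: v :: r | u <- take n us & extends tes (v :: r) u] in
  [/\ context st', regs st' rH = regs st rH, regs st' rU = n,
      queue st' ((v :: r) :: L ++ ext) &
      regs st' rPend = regs st rPend + size ext].
Proof.
move=> ctx qu Vv U0; cbv zeta; elim: n => [|n IHn] le_n.
  by rewrite iter0 take0 /= cats0 addn0.
have [] := IHn (ltnW le_n); move: (@iter_den_frame extend_step n st).
rewrite iterS; set s1 := iter _ _ _ => frame ctx1 H1 U1 qu1 P1.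
have size_us : size us = N by rewrite -(size_map name) name_us size_iota.
have name_n : name (nth s us n) = n.
  by rewrite -(nth_map _ 0) ?size_us // name_us nth_iota.
have Vs1 : regs s1 rV = name v by rewrite frame.
have Us1 : regs s1 rU = name (nth s us n) by rewrite name_n.
have [] := @extend_spec s1 v r _ (nth s us n) ctx1 qu1 Vs1 Us1.
move: (den extend_step s1) => s2.
rewrite name_n (take_nth s) ?size_us // filter_rcons.
case: (extends _ _ _) => ctx2 -> -> qu2 ->.
  by rewrite map_rcons -rcons_cat P1 H1 size_rcons addn1 addnS.
by rewrite P1 H1 addn0.
Qed.

Lemma process_spec st c L :
    context st -> queue st (c :: L) -> uniq c -> c != [::] ->
  let st' := den process st in
  [/\ context st', queue st' (L ++ extensions c),
      regs st' rPend = regs st rPend + size (extensions c) &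
      regs st' rAns = regs st rAns + (head s c == z) * nlabs tes c T].
Proof.
case: c => // v r ctx [defT recs] Uc _; cbv zeta.
have le_HT : regs st rH + R <= regs st rT by rewrite defT /= mulSn; lia.
have [Nn Mm Zz edges leE] := ctx.
have [rec0 tab0] : record_at (mem st) (regs st rH) (v :: r).
  by have := recs 0 isT; rewrite mul0n addn0.
have cell : mem st (regs st rH + M1) = nlabs tes (v :: r) T.
  by have := tab0 (size es) (ltnSn _); rewrite table_sentinel // Uc addn1 addSnnS.
have dist0 a b : (0 < a - b + (b - a)) = (a != b) by lia.
pose st1 := set_reg st rV (name v).
pose st2 := if name v != name z then st1 else
  set_reg st1 rAns (regs st rAns + nlabs tes (v :: r) T).
pose start := Sqc (Asg rV (Mem (Var rH))) (Ite (Dist (Var rV) (Var rZ)) Skip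
  (Asg rAns (Plus (Var rAns) (Mem (Plus (Var rH) (Var rM)))))).
have def_st2 : st2 = den start st.
  by rewrite /= /upd /= rec0 Zz Mm cell dist0.
have Ans2 : regs st2 rAns = regs st rAns + (v == z) * nlabs tes (v :: r) T.
  rewrite /st2 (inj_eq name_inj); case: eqP => _ /=; rewrite ?mul1n //.
  by rewrite addn0.
have frame2 x : x \notin [:: rV; rAns] -> regs st2 x = regs st x.
  by rewrite def_st2; exact: (@den_frame start).
have V2 : regs st2 rV = name v by rewrite /st2; case: ifP.
have m2 : mem st2 = mem st by rewrite /st2; case: ifP.
pose st3 := set_reg st2 rU 0.
have frame3 x : x \notin [:: rV; rAns; rU] -> regs st3 x = regs st x.
  rewrite !inE !negb_or => /and3P[nV nA nU].
  by rewrite /= /upd (negPf nU) frame2 // !inE negb_or nV.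
have ctx3 : context st3.
  apply: context_low ctx _ _ _ _; rewrite ?frame3 ?[mem st3]m2 //; first by lia.
  by move=> x; rewrite !inE => /or4P[]/eqP->; rewrite frame3.
have qu3 : queue st3 ((v :: r) :: L).
  by rewrite /queue !frame3 // [mem st3]m2.
have [] := @extend_loop st3 v r L N ctx3 qu3 V2 erefl (leqnn _).
move: (@iter_den_frame extend_step N st3).
have -> : den process st = den (Asg rH (Plus (Plus (Var rH) (Var rM)) (Cst 1)))
    (iter N (den extend_step) st3).
  rewrite -[N in RHS]Nn -(frame3 rN) //.
  by rewrite /st3 def_st2.
set st4 := iter _ _ _ => frame4 ctx4 H4 _ [defT4 recs4] P4.
have M4 : regs st4 rM = M1 by rewrite frame4 // frame3.
have size_us : size us = N by rewrite -(size_map name) name_us size_iota.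
have def_ext : [seq u :: v :: r | u <- take N us & extends tes (v :: r) u] =
    extensions (v :: r) by rewrite take_oversize ?size_us.
rewrite {}def_ext in defT4 recs4 P4.
have A4 : regs st4 rAns = regs st rAns + (v == z) * nlabs tes (v :: r) T.
  by rewrite frame4 // [LHS]Ans2.
rewrite frame3 // in H4; rewrite frame3 // in P4.
clearbody st4; rewrite /= /upd /= M4 H4; split.
- apply: context_low ctx4 _ _ _ _ => //=; rewrite ?/upd /= ?H4 ?defT4 ?H4; try lia.
  by move=> x; rewrite !inE => /or4P[]/eqP->.
- split; first by rewrite /= /upd /= defT4 H4 /= mulSn; lia.
  move=> q ltq; have := recs4 q.+1 ltq; rewrite /= /upd /= H4.
  by rewrite mulSn addn1 !addnS !addnA.
- exact: P4.
- exact: A4.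
Qed.

(** The part [L] of the queue behind [C] is arbitrary, so that children already appended can join it
    in the induction. *)
Lemma process_loop C L st :
    context st -> queue st (C ++ L) ->
    all (fun c => uniq c && (c != [::])) C ->
  let st' := iter (size C) (den process) st in
  [/\ context st', queue st' (L ++ next_level tes us C),
      regs st' rPend = regs st rPend + size (next_level tes us C) &
      regs st' rAns = regs st rAns +
        \sum_(c <- C | head s c == z) nlabs tes c T].
Proof.
cbv zeta; elim: C L st => [|c C IH] L st ctx qu.
  by rewrite iter0 big_nil (_ : next_level _ _ _ = [::]) // cats0 !addn0.
case/andP=> /andP[Uc nz_c] allC.
have [] := process_spec ctx qu Uc nz_c.
rewrite [size _]/= iterSr; move: (den process st) => s1 ctx1 qu1 P1 A1.
rewrite -catA in qu1; have [] := IH _ _ ctx1 qu1 allC.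
move: (iter _ _ s1) => s2 ctx2 qu2 P2 A2.
rewrite big_cons; split=> //; first by rewrite -catA in qu2.
  by rewrite P2 P1 -addnA [next_level _ _ (c :: C)]/= size_cat.
by rewrite A2 A1; case: (head s c == z); rewrite ?mul1n -?addnA.
Qed.

Local Notation level := (level tes us s).

Definition level_inv (l : nat) (st : state) : Prop :=
  [/\ context st, queue st (level l), regs st rPend = size (level l) &
      regs st rAns =
        \sum_(i < l) \sum_(c <- level i | head s c == z) nlabs tes c T].

Let us_uniq : uniq us.
Proof. by apply: (@map_uniq _ _ name); rewrite name_us iota_uniq. Qed.

Let mem_us u : u \in us.
Proof.
have : name u \in map name us by rewrite name_us mem_iota name_lt.
by case/mapP=> u' u'us /name_inj->.
Qed.

Lemma level_paths l : all (fun c => uniq c && (c != [::])) (level l).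
Proof.
apply/allP=> c; rewrite mem_level // => /and4P[/eqP sz_c _ -> _].
by rewrite -size_eq0 sz_c.
Qed.

Lemma level_step_den st l (st1 := set_reg (set_reg st rCnt (regs st rPend)) rPend 0) :
    level_inv l st ->
  [/\ context st1, queue st1 (level l), regs st1 rPend = 0,
      regs st1 rAns = regs st rAns &
      den level_step st = iter (size (level l)) (den process) st1].
Proof.
move=> [ctx qu Pl Al]; split=> //; last by rewrite -Pl.
Qed.

Lemma level_step_spec l st :
  level_inv l st -> level_inv l.+1 (den level_step st).
Proof.
move=> inv; have [_ _ _ Al] := inv.
have [] := level_step_den inv; move: (set_reg _ _ _) => st1 ctx1 qu1 P1 A1 ->.
rewrite -[level l]cats0 in qu1.
have [] := process_loop ctx1 qu1 (level_paths l).
move: (iter _ _ st1) => st2 ctx2 qu2 P2 A2; split=> //.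
  by rewrite P2 P1.
by rewrite big_ord_recr /= A2 A1 Al.
Qed.

Lemma level_step_cost S l st :
    N <= S -> M1 <= S -> size (level l) <= S -> level_inv l st ->
  cost level_step st <= scost S level_step.
Proof.
move=> leN leM leL inv; have [_ _ Pl _] := inv.
have [] := level_step_den inv; set st1 := set_reg _ _ _ => ctx1 qu1 _ _ _.
have Cnt1 : regs st1 rCnt = size (level l) by [].
(* The constants 4 and 3 are the costs of the two assignments. *)
have -> : cost level_step st = 4 + (3 + cost (Rep (Var rCnt) process) st1) by [].
have -> : scost S level_step = 4 + (3 + scost S (Rep (Var rCnt) process)) by [].
rewrite 2!leq_add2l; apply: leq_trans (@cost_rep_le (Var rCnt) process st1 (scost S process) _) _.
  rewrite -[eval _ _]/(regs st1 rCnt) Cnt1 => i lti.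
  (* Cutting the level at [i] makes [process_loop] describe the state after [i] rounds, where [rN]
     and [rM] still have their values. *)
  have qu1' : queue st1 (take i (level l) ++ drop i (level l)).
    by rewrite cat_take_drop.
  have sz_take : size (take i (level l)) = i by rewrite size_take lti.
  have paths : all (fun c => uniq c && (c != [::])) (take i (level l)).
    by apply/allP=> c /mem_take /(allP (level_paths l)).
  have [[Nn Mm _ _ _] _ _ _] := process_loop ctx1 qu1' paths.
  rewrite sz_take in Nn Mm; apply: (@fixed_cost [:: rN; rM]) => // x.
  by rewrite !inE => /orP[]/eqP->; rewrite ?Nn ?Mm.
by rewrite -[eval _ _]/(regs st1 rCnt) Cnt1 leq_add2l ltnS leq_mul2r leL orbT.
Qed.

Lemma level_loop st n : level_inv 0 st -> level_inv n (iter n (den level_step) st).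
Proof. by move=> inv; elim: n => // n IHn; rewrite iterS; exact: level_step_spec. Qed.

Lemma levels_spec S st :
    N <= S -> M1 <= S -> (forall l, size (level l) <= S) -> level_inv 0 st ->
  regs (den (Rep (Var rN) level_step) st) rAns =
    \sum_(l < N) \sum_(c <- level l | head s c == z) nlabs tes c T /\
  cost (Rep (Var rN) level_step) st <= scost S (Rep (Var rN) level_step).
Proof.
move=> leN leM leL inv; have [[Nn _ _ _ _] _ _ _] := inv.
split.
  have -> : den (Rep (Var rN) level_step) st = iter N (den level_step) st.
    by rewrite -Nn.
  by have [_ _ _ ->] := level_loop N inv.
apply: leq_trans (@cost_rep_le (Var rN) level_step st (scost S level_step) _) _.
  by move=> i _; apply: level_step_cost (level_loop i inv).
by rewrite -[eval _ _]/(regs st rN) Nn leq_add2l ltnS leq_mul2r leN orbT.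
Qed.

Definition word : seq nat :=
  [:: N; T; size es; name s; name z] ++ iota 0 N ++
  flatten [seq [:: name e.1.1; name e.1.2; (val e.2).+1] | e <- es].

Lemma size_word : size word = N + 5 + 3 * size es.
Proof. by rewrite !size_cat size_iota size_flatten3 /= addnCA addnA. Qed.

Lemma nth_word j i : j < size es -> i < 3 ->
  nth 0 word (N + 5 + 3 * j + i) =
  nth 0 [:: (entry j).1.1; (entry j).1.2; (entry j).2] i.
Proof.
move=> ltj lti; rewrite /word catA nth_cat size_cat size_iota /=.
rewrite (_ : _ < _ = false); last by lia.
rewrite (_ : _ - _ = 3 * j + i); last by lia.
rewrite nth_flatten3 //; congr nth; rewrite /edge_entry.
by case: es ltj => // e0 l ltj; rewrite !(nth_map e0).
Qed.

Lemma setup_regs (st := den setup (init word)) :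
  [/\ regs st rN = N, regs st rM = M1, regs st rE = N + 5 &
      regs st rZ = name z] /\
  [/\ regs st rH = size word + 3, regs st rT = size word + 4,
      regs st rPend = 1 & regs st rAns = 0].
Proof.
have gt5 : 5 <= size word by rewrite size_word; lia.
rewrite {}/st /setup /= /upd /= addn1.
by split; split; rewrite // -addnA.
Qed.

Lemma setup_mem (m := mem (den setup (init word))) :
  [/\ forall a, a < size word -> m a = nth 0 word a,
      m (size word) = N, m (size word + 1) = N, m (size word + 2) = T &
      m (size word + 3) = name s].
Proof.
have gt5 : 5 <= size word by rewrite size_word; lia.
have def_m : m = upd (upd (upd (upd (nth 0 word) (size word) N)
    (size word + 1) N) (size word + 2) T) (size word + 3) (name s).
  by rewrite {}/m /setup /= /upd /=.
rewrite {}def_m /upd; split=> [a lta||||];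
  do ?[rewrite (_ : _ == _ = false); last by lia]; by rewrite ?eqxx.
Qed.

Lemma setup_spec (st := den init_table (den setup (init word))) :
  [/\ context st, queue st [:: [:: s]], regs st rPend = 1 & regs st rAns = 0].
Proof.
have [[N1 M1' E1 Z1] [H1 T1 P1 A1]] := setup_regs.
have [m1 mW mW1 mW2 mW3] := setup_mem.
rewrite {}/st; move: (den setup _) N1 M1' E1 Z1 H1 T1 P1 A1 m1 mW mW1 mW2 mW3.
move=> st1 N1 M1' E1 Z1 H1 T1 P1 A1 m1 mW mW1 mW2 mW3.
have -> : den init_table st1 = iter M1 (den (Sqc (Sto (Var rT) (Cst 1)) (Incr rT 1))) st1.
  by rewrite -M1'.
have [] := init_table_spec st1 M1.
move: (@iter_den_frame (Sqc (Sto (Var rT) (Cst 1)) (Incr rT 1)) M1 st1).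
move: (iter _ _ _) => st2 frame m2 t2 T2; rewrite T1 in m2 t2 T2.
split; rewrite ?frame //.
  split; rewrite ?frame // ?E1 ?H1 ?size_word; last by lia.
  move=> j ltj; have [->|neq_j] := eqVneq j (size es).
    have sz := size_word.
    by rewrite entry_sentinel -sz !m2 ?mW ?mW1 ?mW2 //; lia.
  have ltj' : j < size es by lia.
  have sz := size_word; rewrite -[X in mem _ X]addn0 !m2 ?m1; try lia.
  by rewrite !nth_word.
split; first by rewrite (frame rH) // T2 H1 /=; lia.
move=> [|//] _; rewrite mul0n addn0 (frame rH) // H1; split; first by rewrite m2 ?mW3 //; lia.
move=> j ltj; by rewrite -(addnA _ 3 1) t2.
Qed.

Lemma count_cmd_spec S :
    N <= S -> M1 <= S -> (forall l, size (level l) <= S) ->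
  regs (den count_cmd (init word)) rAns =
    \sum_(l < N) \sum_(c <- level l | head s c == z) nlabs tes c T /\
  cost count_cmd (init word) <= scost S count_cmd.
Proof.
move=> leN leM leL; have [ctx qu P1 A1] := setup_spec.
have inv : level_inv 0 (den init_table (den setup (init word))).
  by split; rewrite ?big_ord0.
have [def_ans le_cost] := levels_spec leN leM leL inv.
split; first by rewrite /count_cmd !den_sqc.
rewrite [X in X <= _](_ : _ = cost setup (init word) +
  (cost init_table (den setup (init word)) +
   cost (Rep (Var rN) level_step) (den init_table (den setup (init word))))) //.
rewrite [X in _ <= X](_ : _ = scost S setup +
  (scost S init_table + scost S (Rep (Var rN) level_step))) //.
apply: leq_add; first exact: (@fixed_cost [::]).
apply: leq_add le_cost; apply: (@fixed_cost [:: rM]) => // x.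
by rewrite inE => /eqP->; have [[_ ->]] := setup_regs.
Qed.

End Program.

(** * Running time *)

Lemma size_le_input w : size w <= input_size w.
Proof.
rewrite /input_size; elim: w => [|a w IH]; first by rewrite big_nil.
by rewrite big_cons /= -add1n leq_add.
Qed.

Lemma lt_exp2_bitlen a : a < 2 ^ bitlen a.
Proof. exact: trunc_log_ltn. Qed.

Lemma bounded_init w : bounded (input_size w) (init w).
Proof.
move=> x; split.
  rewrite /= /upd; case: eqP => _; last by rewrite expn_gt0.
  exact: leq_ltn_trans (size_le_input w) (ltn_expl _ _).
rewrite /input_size /=; elim: w x => [|a w IH] [|x]; rewrite ?expn_gt0 //= big_cons.
  by apply: leq_trans (lt_exp2_bitlen a) _; rewrite leq_exp2l // leq_addr.
by apply: leq_trans (IH x) _; rewrite leq_exp2l // leq_addl.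
Qed.

Lemma agree_refl K st : agree K st st.
Proof. by []. Qed.

(** * Computable bounds and transfer to machine time *)

Definition double : cmd := Asg 1 (Plus (Var 1) (Var 1)).

Lemma iter_double m st :
  regs (iter m (den double) st) 1 = regs st 1 * 2 ^ m.
Proof.
elim: m => [|m IH]; first by rewrite iter0 muln1.
by rewrite iterS /= /upd /= IH addnn -mul2n expnS mulnCA.
Qed.

Lemma iter_rep_double k b st :
  regs (iter k (den (Rep (Cst b) double)) st) 1 = regs st 1 * 2 ^ (k * b).
Proof.
elim: k => [|k IH]; first by rewrite iter0 muln1.
by rewrite iterS [LHS]iter_double IH -mulnA -expnD mulSn addnC.
Qed.

(** The argument sits in memory cell 0, and [k * b] doublings of [a] replace multiplication. *)
Lemma computable_exp2 a b : computable (fun k => a * 2 ^ (k * b)).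
Proof.
pose c := Sqc (Asg 1 (Cst a)) (Sqc (Rep (Mem (Cst 0)) (Rep (Cst b) double))
  (Asg 0 (Var 1))).
exists (comp 2 c) => k.
have [st [ex [agr _] _]] :=
  @comp_correct 2 c 2 _ _ isT (leqnn 2) (agree_refl 2 (init [:: k])).
pose C := max_const (comp 2 c); pose n := input_size [:: k].
have bst : bounded (C.+1 + n) (init [:: k]).
  move=> x; have [? ?] := bounded_init [:: k] x.
  have := leq_pexp2l (isT : 0 < 2) (leq_addl C.+1 n).
  by split; apply: leq_trans (_ : 2 ^ n <= _).
have ltC : max_const (comp 2 c) < 2 ^ (C.+1 + n).
  rewrite -/C; apply: ltn_trans (ltn_expl C (isT : 1 < 2)) _.
  by rewrite ltn_exp2l // ltnS leq_addr.
have [_ /(_ _ (leqnn _)) [t ex' _]] := exec_of_uexec ex ltC isT bst.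
by exists t, st; split=> //; rewrite /output agr // [LHS]iter_rep_double.
Qed.

Lemma fpt_of_cmd (I : Type) (encodes : I -> seq nat -> Prop)
    (count : I -> nat) (param : I -> nat) (K : nat) (c : cmd) :
    cvars_below K c -> 0 < K -> 0 < loop_depth c ->
    (forall x w, encodes x w -> [/\ 0 < size w,
       regs (den c (init w)) 0 = count x &
       cost c (init w) <= scost (input_size w * 2 ^ param x) c]) ->
  fixed_parameter_tractable encodes count param.
Proof.
move=> vK K_gt0 d_gt0 correct; set d := loop_depth c in d_gt0.
(* With [n <= A * S ^ d] steps on numbers of at most [C + s0 + n] bits, the time is at most
   [B * S ^ (2 * d)]. Positive loop depth gives [s0 <= S ^ d]. *)
pose C := (max_const (comp K c)).+1; pose A := scost 1 c.
pose B := 2 * A * (C.+1 + A).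
exists (comp K c), (fun k => B * 2 ^ (k * (2 * d))), (2 * d).
split=> [|x w /correct[w_gt0 def_res le_cost]]; first exact: computable_exp2.
have [st [ex [agr _] _]] :=
  comp_correct vK (leqnn K) (agree_refl K (init w)).
set s0 := input_size w in le_cost *; set k := param x in le_cost *.
have s0_gt0 : 0 < s0 by apply: leq_trans w_gt0 (size_le_input w).
pose S := s0 * 2 ^ k.
have S_gt0 : 0 < S by rewrite muln_gt0 s0_gt0 expn_gt0.
have le_n : cost c (init w) <= A * S ^ d := leq_trans le_cost (scost_le c S_gt0).
set n := cost c (init w) in ex le_n.
have bst : bounded (C + s0) (init w).
  move=> y; have [? ?] := bounded_init w y.
  have := leq_pexp2l (isT : 0 < 2) (leq_addl C s0).
  by split; apply: leq_trans (_ : 2 ^ s0 <= _).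
have ltC : max_const (comp K c) < 2 ^ (C + s0).
  rewrite -/C; apply: ltn_trans (ltn_expl _ (isT : 1 < 2)) _.
  by rewrite ltn_exp2l // leq_addr.
have [_ /(_ _ (leqnn _)) [t ex' le_t]] := exec_of_uexec ex ltC isT bst.
exists t, st; split=> //; first by rewrite /output agr.
apply: leq_trans le_t _.
have le_s0 : s0 <= S ^ d.
  apply: leq_trans (_ : S <= _); first by rewrite leq_pmulr // expn_gt0.
  by rewrite -[X in X <= _]expn1 leq_pexp2l.
have Y_gt0 : 0 < S ^ d by rewrite expn_gt0 S_gt0.
have -> : B * 2 ^ (k * (2 * d)) * s0 ^ (2 * d) = B * (S ^ d * S ^ d).
  rewrite -mulnA; congr (_ * _).
  by rewrite -[RHS]expnD addnn -mul2n expnMn -expnM mulnC.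
move: (S ^ d) le_n le_s0 Y_gt0 => Y le_n le_s0 Y_gt0.
have le_b : C + s0 + n <= (C.+1 + A) * Y.
  rewrite mulnDl leq_add // mulSn addnC leq_add // leq_pmulr //.
rewrite /B (_ : 2 * A * (C.+1 + A) * (Y * Y) = A * Y * (2 * ((C.+1 + A) * Y))).
  by rewrite leq_mul // leq_mul2l le_b.
by rewrite -!mulnA; lia.
Qed.

Theorem theorem5 :
  fixed_parameter_tractable tp_encodes count_temporal_paths fen_underlying.
Proof.
(* The program uses registers 0 to 16; scratch space starts at 17. *)
apply: (@fpt_of_cmd _ _ _ _ 17 count_cmd) => //.
move=> [G s z] w encodes_w.
have [name [es [name_inj name_lt tesE ->]]] : exists (name : vertex G -> nat)
    (es : seq (vertex G * vertex G * 'I_(lifetime G))),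
  [/\ injective name, forall v, name v < #|vertex G|,
     perm_eq (map (@unordered _ _) es) (enum (time_edges G)) &
     w = word name es s z] := encodes_w.
set N := #|vertex G|; set T := lifetime G.
pose tes := map (@unordered _ T) es.
have es_loopless : {in es, forall e, e.1.1 != e.1.2}.
  move=> e eE; have : unordered e \in time_edges G.
    by rewrite -mem_enum -(perm_mem tesE); apply: map_f.
  by move/time_edges_card2; rewrite /= cards2; case: (_ != _).
have [|||_ memN] := uniq_min_size (s1 := map name (enum (vertex G)))
  (s2 := iota 0 N) _ _ _.
- by rewrite map_inj_uniq ?enum_uniq.
- by move=> _ /mapP[v _ ->]; rewrite mem_iota name_lt.
- by rewrite size_iota size_map -cardE.
(* By injectivity and counting, every number below [N] is a name, so the default [s] is never
   taken. *)
pose us := [seq odflt s [pick v | name v == i] | i <- iota 0 N].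
have name_us : map name us = iota 0 N.
  rewrite -map_comp -[RHS]map_id; apply/eq_in_map => i /=.
  rewrite -memN => /mapP[v _ ->].
  by case: pickP => [u /eqP //|/(_ v)]; rewrite eqxx.
have us_uniq : uniq us by apply: (@map_uniq _ _ name); rewrite name_us iota_uniq.
have mem_us u : u \in us.
  have : name u \in map name us by rewrite name_us mem_iota name_lt.
  by case/mapP=> u' u'us /name_inj->.
set w0 := word _ _ _ _.
(* This [S] dominates the vertex count, the table length and, since [N] is at most the input size,
   every level. *)
set k := fen_underlying _; pose S := input_size w0 * 2 ^ k.
have le_w0 : size w0 <= S.
  by apply: leq_trans (size_le_input w0) _; rewrite leq_pmulr ?expn_gt0.
have sz_w0 : size w0 = N + 5 + 3 * size es by exact: size_word.
have leL l : size (level tes us s l) <= S.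
  have memA : underlying_graph G =i [seq e.1 | e <- tes].
    move=> e; apply/imsetP/mapP => -[e' e'E ->]; exists e' => //.
      by rewrite (perm_mem tesE) mem_enum.
    by rewrite -mem_enum -(perm_mem tesE).
  have A2 : {in underlying_graph G, forall e : {set vertex G}, #|e| = 2}.
    by move=> _ /imsetP[e /time_edges_card2 ? ->].
  apply: leq_trans (size_level s us_uniq mem_us l A2 memA) _.
  rewrite leq_mul //; apply: leq_trans (size_le_input w0); rewrite sz_w0.
  by lia.
have [|||def_ans le_cost] := count_cmd_spec name_inj name_lt es_loopless name_us
  (s := s) z (S := S).
- by apply: leq_trans le_w0; rewrite sz_w0 -addnA leq_addr.
- by apply: leq_trans le_w0; rewrite sz_w0; lia.
- exact: leL.
split; last exact: le_cost; first by rewrite sz_w0; lia.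
by rewrite def_ans -num_temporal_pathsE.
Qed.
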